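(* Let $M^n$ be a closed connected manifold and let $(g_t)_{t\le 0}$ be an ancient super Ricci flow on $M$, i.e. a smooth $1$-parameter family of Riemannian metrics, defined for all $t\le 0$, satisfying $\partial_t g_t \geq -2\,\mathrm{Ric}_t$ as bilinear forms for all $t\le 0$. Then every smooth, positive, bounded solution $u_t(x)=u(x,t)$ to the heat equation $\partial_t u_t = \Delta_t u_t$ defined on $M$ for all $t \leq 0$ is constant (in space and time).
   Context: Closed means compact without boundary. $\mathrm{Ric}_t$ is the Ricci tensor and $\Delta_t=\mathrm{div}_t\circ\nabla^t$ the Laplace--Beltrami operator of $(M,g_t)$. Bounded means that there is a constant $A>0$ with $u(x,t)\le A$ for all $x\in M$, $t\le 0$. *)

(* Defs.v *)
From mathcomp Require Import all_boot all_order all_algebra.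
From mathcomp Require Import all_classical all_reals all_analysis.

Set Implicit Arguments.
Unset Strict Implicit.
Unset Printing Implicit Defensive.
Import Order.TTheory GRing.Theory Num.Theory numFieldNormedType.Exports.

Local Open Scope classical_set_scope.
Local Open Scope ring_scope.

Section smoothness.
Context {R : realType} {V W : normedModType R}.
Implicit Types (f : V -> W) (U A : set V).

(* C^k on an open set U. On the finite-dimensional spaces used below, having
   C^(k-1) derivatives in all directions is the usual notion of C^k. *)
Fixpoint Ck (k : nat) U f : Prop :=
  (forall x, U x -> {for x, continuous f}) /\
  match k with
  | 0%N => True
  | k'.+1 => forall v : V,
      (forall x, U x -> derivable f x v) /\ Ck k' U (fun x => 'D_v f x)
  end.

(* Smoothness on an arbitrary set, by local smooth extension: this covers
   half-open cylinders such as U `*` `]-oo, 0], and gives the usual notion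
   when A is open. *)
Definition smooth_on A f : Prop :=
  forall x, A x -> exists U (F : V -> W),
    [/\ open U, U x, (forall k, Ck k U F) & forall y, A y -> U y -> F y = f y].

End smoothness.

(* A smooth structure is given by an atlas, which need not be maximal;
   [chart i] and [chartV i] are meaningful on [dom i] and on its image only. *)
Record manifold (R : realType) (n : nat) := Manifold {
  pt :> topologicalType;
  atlas : Type;
  dom : atlas -> set pt;
  chart : atlas -> pt -> 'rV[R]_n;
  chartV : atlas -> 'rV[R]_n -> pt;
  pt_hausdorff : hausdorff_space pt;
  pt_second_countable : @second_countable pt;
  dom_open : forall i, open (dom i);
  dom_cover : forall x, exists i, dom i x;
  chart_open : forall i, open (chart i @` dom i);
  chartK : forall i x, dom i x -> chartV i (chart i x) = x;
  chart_continuous : forall i, {within dom i, continuous (chart i)};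
  chartV_continuous :
    forall i, {within chart i @` dom i, continuous (chartV i)};
  transition_smooth : forall i j,
    smooth_on (chart i @` (dom i `&` dom j)) (chart j \o chartV i)
}.
Arguments dom {R n m} i _.
Arguments chart {R n m} i _.
Arguments chartV {R n m} i _.

Section local_geometry.
Context {R : realType} {n : nat}.
Implicit Types (g : 'rV[R]_n -> 'M[R]_n) (f : 'rV[R]_n -> R).

Definition partial (a : 'I_n) f (y : 'rV[R]_n) : R := 'D_(delta_mx 0 a) f y.

Definition bilin (B : 'M[R]_n) (v w : 'rV[R]_n) : R := (v *m B *m w^T) 0 0.

(* Gamma^c_ab of the Levi-Civita connection *)
Definition christoffel g (c a b : 'I_n) (y : 'rV[R]_n) : R :=
  2^-1 * \sum_(l < n) invmx (g y) c l *
    (partial a (fun z => g z b l) y + partial b (fun z => g z a l) y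
     - partial l (fun z => g z a b) y).

(* R(d_a, d_b) d_c = sum_d (riemann g d c a b) d_d, with the sign convention
   R(X, Y) = [nabla_X, nabla_Y] - nabla_[X, Y] *)
Definition riemann g (d c a b : 'I_n) (y : 'rV[R]_n) : R :=
  partial a (christoffel g d b c) y - partial b (christoffel g d a c) y
  + \sum_(e < n) (christoffel g d a e y * christoffel g e b c y
                  - christoffel g d b e y * christoffel g e a c y).

(* Ric(X, Y) = tr (Z |-> R(Z, X) Y), positive on round spheres *)
Definition ricci g (y : 'rV[R]_n) : 'M[R]_n :=
  \matrix_(a, b) \sum_(c < n) riemann g c b c a y.

Definition grad g f (y : 'rV[R]_n) : 'rV[R]_n :=
  \row_a \sum_(b < n) invmx (g y) a b * partial b f y.

(* div X = tr (nabla X) *)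
Definition divergence g (X : 'rV[R]_n -> 'rV[R]_n) (y : 'rV[R]_n) : R :=
  \sum_(a < n) (partial a (fun z => X z 0 a) y
                + \sum_(b < n) christoffel g a a b y * X y 0 b).

Definition laplacian g f : 'rV[R]_n -> R := divergence g (grad g f).

End local_geometry.

(* Time derivative on the half-line t <= 0: two-sided for t < 0 and
   from the left at t = 0. *)
Definition dt {R : realType} (f : R -> R) (t : R) : R :=
  lim ((fun s => (f s - f t) / (s - t)) @ within [set s | s <= 0] t^').

Section metrics.
Context {R : realType} {n : nat} (M : manifold R n).

(* A symmetric (0,2)-tensor field is given by its matrix in each chart, as a
   function of the coordinates. *)
Definition tensor02 := atlas M -> 'rV[R]_n -> 'M[R]_n.

(* With row vectors the Jacobian 'J of a transition map acts on tangent
   vectors by right multiplication, v |-> v *m 'J, which fixes the form of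
   the change of coordinates. *)
Definition riemannian_metric (g : tensor02) : Prop :=
  [/\ forall i, smooth_on (chart i @` dom i) (g i),
      forall i (x : M), dom i x -> (g i (chart i x))^T = g i (chart i x),
      forall i (x : M) (v : 'rV[R]_n), dom i x -> v != 0 ->
        0 < bilin (g i (chart i x)) v v
    & forall i j (x : M), dom i x -> dom j x ->
        let J := jacobian (chart j \o chartV i) (chart i x) in
        g i (chart i x) = J *m g j (chart j x) *m J^T].

Definition ancient_metric_family (g : R -> tensor02) : Prop :=
  (forall t, t <= 0 -> riemannian_metric (g t)) /\
  forall i, smooth_on ((chart i @` dom i) `*` [set t : R | t <= 0])
    (fun p : 'rV[R]_n * R => g p.2 i p.1).

Definition dt_metric (g : R -> tensor02) (t : R) : tensor02 :=
  fun i y => \matrix_(a, b) dt (fun s => g s i y a b) t.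

Definition ancient_super_ricci_flow (g : R -> tensor02) : Prop :=
  ancient_metric_family g /\
  forall t i (x : M) (v : 'rV[R]_n), t <= 0 -> dom i x ->
    - 2 * bilin (ricci (g t i) (chart i x)) v v
      <= bilin (dt_metric g t i (chart i x)) v v.

Definition ancient_smooth (u : M -> R -> R) : Prop :=
  forall i, smooth_on ((chart i @` dom i) `*` [set t : R | t <= 0])
    (fun p : 'rV[R]_n * R => u (chartV i p.1) p.2).

Definition ancient_heat_solution (g : R -> tensor02) (u : M -> R -> R) : Prop :=
  forall t i (x : M), t <= 0 -> dom i x ->
    dt (u x) t = laplacian (g t i) (fun y => u (chartV i y) t) (chart i x).

End metrics.

(* Main.v *)
From HB Require Import structures.
Require Import Defs.
From mathcomp Require Import all_boot all_order all_algebra.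
From mathcomp Require Import all_classical all_reals all_analysis.
From mathcomp Require Import ring lra.
Import Order.TTheory GRing.Theory Num.Theory numFieldNormedType.Exports.
Local Open Scope classical_set_scope.
Local Open Scope ring_scope.
Set Implicit Arguments.
Unset Strict Implicit.
Unset Printing Implicit Defensive.

(* Bernstein's method. By Bochner's formula and the super Ricci flow inequality,
   |grad u|^2 is a subsolution of the heat equation, and the heat operator maps
   u^2 to -2 |grad u|^2; hence 2 (t - t0) |grad u|^2 + u^2 is a subsolution, and
   the maximum principle on [t0, t] bounds it by the maximum of u^2 at time t0,
   so by A^2. Dividing by t - t0 and letting t0 -> -oo gives grad u = 0, whence
   also d_t u = Delta u = 0.

   Bochner's formula is proved in arbitrary coordinates: with X = grad u and
   S^a_b = nabla_b X^a one has grad |grad u|^2 = 2 S X, and by the contracted Ricci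
   identity nabla_a S^a_c = d_c (Delta u) + Ric_ce X^e. All arguments are run at
   times t < 0, where the cylinders chart x ]-oo, 0[ are open; t = 0 follows by
   continuity. *)

(** * Calculus of smooth functions *)

(** [Ck] only speaks of derivatives in fixed directions. Linearity in the direction, symmetry of
    mixed derivatives, differentiability and the chain rule therefore have to be extracted from
    continuity of the directional derivatives before any geometry starts.

    The maximum principle is run in one chart around the maximum point, so the Laplacian is never
    compared between charts. Only |grad u|^2 is, because the function being maximised must live on M
    x R.

    No limit is taken in the estimate. If q = |grad u|^2 were positive at (x, t), the perturbation
    eps = q would still leave (t - t0) q + u^2 <= A^2, which is false for the t0 with (t - t0) q =
    A^2 + 1. *)

Lemma near_open (T : topologicalType) (U : set T) (P : T -> Prop) x :
  open U -> U x -> (forall y, U y -> P y) -> \forall y \near x, P y.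
Proof.
move=> oU Ux UP; have : nbhs x U by exact: open_nbhs_nbhs.
by apply: filterS.
Qed.

Section Ck_theory.
Context {R : realType} {V W : normedModType R}.
Implicit Types (U A : set V) (f g : V -> W).

Lemma Ck_sub k U A f : A `<=` U -> Ck k U f -> Ck k A f.
Proof.
move=> AU; elim: k f => [|k IH] f /= [cf df]; split=> //.
- by move=> x Ax; exact/cf/AU.
- by move=> x Ax; exact/cf/AU.
- by move=> v; have [dv Cv] := df v; split=> [x Ax|]; [exact/dv/AU|exact: IH].
Qed.

Lemma Ck_local k A f :
  (forall x, A x -> exists U, [/\ open U, U x & Ck k U f]) -> Ck k A f.
Proof.
elim: k f => [|k IH] f /= H; (split; last first) => //.
- by move=> x /H[U [_ Ux [cf _]]]; exact: cf.
- move=> v; split=> [x /H[U [_ Ux [_ /(_ v) [df _]]]]|]; first exact: df.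
  by apply: IH => x /H[U [oU Ux [_ /(_ v) [_ Cf]]]]; exists U.
- by move=> x /H[U [_ Ux [cf _]]]; exact: cf.
Qed.

(** Openness matters: a derivative at a point of [U] sees a whole neighbourhood, on which [f] and
    [g] must agree. *)
Lemma eq_Ck k U f g : open U -> (forall x, U x -> f x = g x) ->
  Ck k U f -> Ck k U g.
Proof.
move=> oU; elim: k f g => [|k IH] f g fg /= [cf df].
all: have nfg x : U x -> \forall y \near x, f y = g y
  by move=> Ux; exact: (near_open oU).
all: have cg x : U x -> {for x, continuous g}.
1,3: move=> Ux; apply: cvg_trans (near_eq_cvg (nfg x Ux)) _;
  by rewrite -(fg _ Ux); exact: cf.
- by split.
- split=> // v; have [dv Cv] := df v; split=> [x Ux|].
  + exact: near_eq_derivable (nfg x Ux) (dv x Ux).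
  + by apply: IH Cv => x Ux; apply/near_eq_derive/nfg.
Qed.

Lemma CkW k U f : Ck k.+1 U f -> Ck k U f.
Proof.
elim: k f => [|k IH] f /= [cf df]; split=> // v.
by have [dv Cv] := df v; split=> //; exact: IH.
Qed.

Lemma smooth_on_open A f k : open A -> smooth_on A f -> Ck k A f.
Proof.
move=> oA sf; apply: Ck_local => x Ax.
have [U [F [oU Ux CF eF]]] := sf x Ax.
exists (A `&` U); split=> //; first exact: openI.
apply: (@eq_Ck _ _ F); first exact: openI.
  by move=> y [Ay Uy]; exact: eF.
by apply: Ck_sub (CF k) => y [].
Qed.

End Ck_theory.

Section smooth_theory.
Context {R : realType} {V : normedModType R}.
Implicit Types (U A : set V) (f g : V -> R).

Lemma Ck_coord m p k U (f : V -> 'M[R]_(m, p)) i j :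
  open U -> Ck k U f -> Ck k U (fun x => f x i j).
Proof.
move=> oU; elim: k f => [|k IH] f /= [cf df].
all: have cg x : U x -> {for x, continuous (fun x => f x i j)}
  by move=> Ux; apply: (@continuous_comp _ _ _ f (fun M : 'M[R]_(m, p) => M i j));
     [exact: cf|exact: coord_continuous].
- by split.
- split=> // v; have [dv Cv] := df v; split=> [x Ux|].
    by have /derivable_mxP := dv x Ux; exact.
  apply: eq_Ck (IH _ Cv) => // x Ux.
  by rewrite derive_mx ?mxE//; exact: dv.
Qed.

Lemma Ck_cst k U (c : R) : Ck k U (fun=> c).
Proof.
elim: k c => [|k IH] c /=; split=> //; try by move=> x _; exact: cvg_cst.
move=> v; split=> [x _|]; first exact: derivable_cst.
have -> : (fun x => 'D_v (fun=> c) x) = (fun=> 0 : R).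
  by apply/funext => x; exact: derive_cst.
exact: IH.
Qed.

Lemma CkD k U f g : open U -> Ck k U f -> Ck k U g ->
  Ck k U (fun x => f x + g x).
Proof.
move=> oU; elim: k f g => [|k IH] f g /= [cf df] [cg dg].
all: have c x : U x -> {for x, continuous (fun x => f x + g x)}
  by move=> Ux; apply: cvgD; [exact: cf|exact: cg].
- by split.
- split=> // v; have [dfv Cf] := df v; have [dgv Cg] := dg v.
  split=> [x Ux|]; first by apply: derivableD; [exact: dfv|exact: dgv].
  apply: eq_Ck (IH _ _ Cf Cg) => // x Ux.
  by rewrite -[RHS]/('D_v (f + g) x) deriveD//; [exact: dfv|exact: dgv].
Qed.

Lemma CkM k U f g : open U -> Ck k U f -> Ck k U g ->
  Ck k U (fun x => f x * g x).
Proof.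
move=> oU; elim: k f g => [|k IH] f g Cf Cg.
  move: Cf Cg => /= [cf _] [cg _].
  by split=> // x Ux; apply: cvgM; [exact: cf|exact: cg].
(* The derivative f g' + g f' also contains the undifferentiated factors, which the induction needs
   one order lower. *)
have Cf' := CkW Cf; have Cg' := CkW Cg.
move: Cf Cg => /= [cf df] [cg dg].
split=> [x Ux|v]; first by apply: cvgM; [exact: cf|exact: cg].
have [dfv Cfv] := df v; have [dgv Cgv] := dg v.
split=> [x Ux|]; first by apply: derivableM; [exact: dfv|exact: dgv].
apply: eq_Ck (CkD oU (IH _ _ Cf' Cgv) (IH _ _ Cg' Cfv)) => // x Ux.
by rewrite -[RHS]/('D_v (f * g) x) deriveM//; [exact: dfv|exact: dgv].
Qed.

Lemma CkV k U f : open U -> (forall x, U x -> f x != 0) ->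
  Ck k U f -> Ck k U (fun x => (f x)^-1).
Proof.
move=> oU f0; elim: k f f0 => [|k IH] f f0 Cf.
  move: Cf => /= [cf _].
  by split=> // x Ux; apply: cvgV; [exact: f0|exact: cf].
have Cf' := CkW Cf; have CI := IH _ f0 Cf'.
move: Cf => /= [cf df].
split=> [x Ux|v]; first by apply: cvgV; [exact: f0|exact: cf].
have [dfv Cfv] := df v.
split=> [x Ux|]; first by apply: derivableV; [exact: f0|exact: dfv].
apply: eq_Ck (CkM oU (CkM oU (Ck_cst k U (-1)) (CkM oU CI CI)) Cfv) => // x Ux.
rewrite deriveV//; [|exact: f0|exact: dfv].
by rewrite mulN1r -invfM -expr2.
Qed.

Definition smooth U f : Prop := forall k, Ck k U f.

Section fixed_open.
Variables (U : set V) (oU : open U).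

Lemma smooth_continuous f x : smooth U f -> U x -> {for x, continuous f}.
Proof. by move=> /(_ 0%N) [cf _] /cf. Qed.

Lemma smooth_derivable f x v : smooth U f -> U x -> derivable f x v.
Proof. by move=> /(_ 1%N) [_ /(_ v)[df _]] /df. Qed.

Lemma smooth_derive f v : smooth U f -> smooth U ('D_v f).
Proof. by move=> sf k; have [_ /(_ v)[_ ]] := sf k.+1. Qed.

Lemma smooth_cst (c : R) : smooth U (fun=> c).
Proof. by move=> k; exact: Ck_cst. Qed.

Lemma smoothD f g : smooth U f -> smooth U g -> smooth U (fun x => f x + g x).
Proof. by move=> sf sg k; exact: CkD. Qed.

Lemma smoothM f g : smooth U f -> smooth U g -> smooth U (fun x => f x * g x).
Proof. by move=> sf sg k; exact: CkM. Qed.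

Lemma smoothN f : smooth U f -> smooth U (fun x => - f x).
Proof.
move=> sf; under eq_fun do rewrite -mulN1r.
by apply: smoothM => //; exact: smooth_cst.
Qed.

Lemma smoothB f g : smooth U f -> smooth U g -> smooth U (fun x => f x - g x).
Proof. by move=> sf sg; apply: smoothD => //; exact: smoothN. Qed.

Lemma smoothV f : (forall x, U x -> f x != 0) -> smooth U f ->
  smooth U (fun x => (f x)^-1).
Proof. by move=> f0 sf k; exact: CkV. Qed.

Lemma smooth_sum I (r : seq I) (P : pred I) (f : I -> V -> R) :
  (forall i, smooth U (f i)) -> smooth U (fun x => \sum_(i <- r | P i) f i x).
Proof.
move=> sf; elim: r => [|i r IH].
  by under eq_fun do rewrite big_nil; exact: smooth_cst.
under eq_fun do rewrite big_cons; case: (P i) => //.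
exact: smoothD.
Qed.

Lemma smooth_prod I (r : seq I) (P : pred I) (f : I -> V -> R) :
  (forall i, smooth U (f i)) -> smooth U (fun x => \prod_(i <- r | P i) f i x).
Proof.
move=> sf; elim: r => [|i r IH].
  by under eq_fun do rewrite big_nil; exact: smooth_cst.
under eq_fun do rewrite big_cons; case: (P i) => //.
exact: smoothM.
Qed.

Lemma eq_smooth f g : (forall x, U x -> f x = g x) -> smooth U f -> smooth U g.
Proof. by move=> fg sf k; exact: eq_Ck fg (sf k). Qed.

Lemma smooth_det m (G : V -> 'M[R]_m) :
  (forall i j, smooth U (fun x => G x i j)) -> smooth U (fun x => \det (G x)).
Proof.
move=> sG; apply: smooth_sum => s.
by apply: smoothM; [exact: smooth_cst|exact: smooth_prod].
Qed.

(** Cramer's rule: each entry is a cofactor, polynomial in the entries of [G], divided by a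
    nonvanishing determinant. *)
Lemma smooth_invmx m (G : V -> 'M[R]_m) :
  (forall x, U x -> G x \in unitmx) ->
  (forall i j, smooth U (fun x => G x i j)) ->
  forall i j, smooth U (fun x => invmx (G x) i j).
Proof.
move=> uG sG i j.
have s : smooth U (fun x => (\det (G x))^-1 *
    ((-1) ^+ (j + i) * \det (row' j (col' i (G x))))).
  apply: smoothM; first apply: smoothV.
  - by move=> x /uG; rewrite unitmxE unitfE.
  - exact: smooth_det.
  - apply: smoothM; first exact: smooth_cst.
    by apply: smooth_det => a b; under eq_fun do rewrite !mxE; exact: sG.
apply: eq_smooth s => x Ux.
by rewrite /invmx uG// !mxE.
Qed.

Lemma deriveDE f g v x : smooth U f -> smooth U g -> U x ->
  'D_v (fun y => f y + g y) x = 'D_v f x + 'D_v g x.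
Proof.
by move=> sf sg Ux; apply: (@deriveD _ _ _ f g); exact: smooth_derivable.
Qed.

Lemma deriveBE f g v x : smooth U f -> smooth U g -> U x ->
  'D_v (fun y => f y - g y) x = 'D_v f x - 'D_v g x.
Proof.
by move=> sf sg Ux; apply: (@deriveB _ _ _ f g); exact: smooth_derivable.
Qed.

Lemma deriveME f g v x : smooth U f -> smooth U g -> U x ->
  'D_v (fun y => f y * g y) x = f x * 'D_v g x + 'D_v f x * g x.
Proof.
move=> sf sg Ux; rewrite -[LHS]/('D_v (f * g) x) deriveM.
- by rewrite [in RHS](mulrC ('D_v f x)).
- exact: smooth_derivable sf Ux.
- exact: smooth_derivable sg Ux.
Qed.

Lemma derive_cstM c f v x : smooth U f -> U x ->
  'D_v (fun y => c * f y) x = c * 'D_v f x.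
Proof.
move=> sf Ux; rewrite deriveME //; last exact: smooth_cst.
by rewrite derive_cst mul0r addr0.
Qed.

Lemma derive_sumE I (r : seq I) (P : pred I) (f : I -> V -> R) v x :
  (forall i, smooth U (f i)) -> U x ->
  'D_v (fun y => \sum_(i <- r | P i) f i y) x = \sum_(i <- r | P i) 'D_v (f i) x.
Proof.
move=> sf Ux; elim: r => [|i r IH].
  by under eq_fun do rewrite big_nil; rewrite big_nil derive_cst.
under eq_fun do rewrite big_cons; rewrite big_cons; case: (P i) => //.
by rewrite deriveDE ?IH//; exact: smooth_sum.
Qed.

Lemma eq_derive f g v x : (forall y, U y -> f y = g y) -> U x ->
  'D_v f x = 'D_v g x.
Proof.
move=> fg Ux; apply: near_eq_derive.
exact: (near_open oU).
Qed.

End fixed_open.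
End smooth_theory.

(** * Mean values along lines, symmetry of mixed derivatives, linearity in the direction *)

Section second_order.
Context {R : realType} {V : normedModType R}.
Implicit Types (U A : set V) (f g : V -> R).

Lemma is_derive_line f x v s : derivable f (s *: v + x) v ->
  is_derive s 1 (fun r : R => f (r *: v + x)) ('D_v f (s *: v + x)).
Proof.
have E : (fun h : R => h^-1 *: (((fun r : R => f (r *: v + x)) \o shift s)
      (h *: 1) - f (s *: v + x))) =
    (fun h => h^-1 *: ((f \o shift (s *: v + x)) (h *: v) - f (s *: v + x))).
  by apply/funext => h /=; rewrite [h *: 1]mulr1 scalerDl addrA.
by move=> df; split; rewrite /derivable /derive E.
Qed.

(** The one-variable chain rule for s |-> c s followed by the restriction of [f] to a line; it
    covers c = 0 and needs derivability along [v] only. *)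
Lemma derive_scale f x v (c : R) : derivable f x v ->
  'D_(c *: v) f x = c * 'D_v f x.
Proof.
move=> df.
have := @is_derive_line f x v 0; rewrite scale0r add0r => /(_ df) d0.
have dc : is_derive (0 : R) 1 (fun s : R => c * s) c.
  have := @is_deriveZ _ _ _ (id : R -> R) c 0 1 1 _.
  by rewrite [c *: 1]mulr1; apply; exact: is_derive_id.
have := @is_derive1_comp _ (fun r : R => f (r *: v + x)) (fun s : R => c * s) 0.
rewrite mulr0 => /(_ _ _ d0 dc) dfc.
have E : (fun h : R => h^-1 *: (((fun r : R => f (r *: v + x)) \o
      (fun s : R => c * s) \o shift 0) (h *: 1) -
      ((fun r : R => f (r *: v + x)) \o (fun s : R => c * s)) 0)) =
    (fun h => h^-1 *: ((f \o shift x) (h *: (c *: v)) - f x)).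
  apply/funext => h /=.
  by rewrite mulr0 scale0r add0r [h *: 1]mulr1 addr0 scalerA (mulrC c).
move: (@derive_val _ _ _ _ _ _ _ dfc); rewrite mulrC => <-.
by rewrite /derive E.
Qed.

Lemma MVT_line_open f x v :
  (forall s : R, 0 <= s <= 1 -> derivable f (s *: v + x) v) ->
  exists2 s : R, 0 < s < 1 & f (v + x) - f x = 'D_v f (s *: v + x).
Proof.
move=> df.
have [||s s01] := @MVT R (fun r : R => f (r *: v + x))
  (fun s => 'D_v f (s *: v + x)) 0 1 ltr01.
- move=> s; rewrite in_itv/= => /andP[s0 s1]; apply: is_derive_line.
  by apply: df; rewrite !ltW.
- apply: derivable_within_continuous => s; rewrite in_itv/= => s01.
  by apply: ex_derive; apply: is_derive_line; apply: df.
rewrite scale1r scale0r add0r subr0 mulr1 => E.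
by exists s => //; move: s01; rewrite in_itv.
Qed.

Lemma MVT_line f x v :
  (forall s : R, 0 <= s <= 1 -> derivable f (s *: v + x) v) ->
  exists2 s : R, 0 <= s <= 1 & f (v + x) - f x = 'D_v f (s *: v + x).
Proof.
move=> /MVT_line_open[s /andP[s0 s1] ->].
by exists s => //; rewrite !ltW.
Qed.

Lemma near_parallelogram (U : set V) x v w : open U -> U x ->
  \forall h \near (0 : R), forall s t : R, 0 <= s <= 1 -> 0 <= t <= 1 ->
    U (s *: (h *: v) + (t *: (h *: w) + x)).
Proof.
move=> oU Ux.
have /nbhs_ballP[e /= e0 eU] : nbhs x U by exact: open_nbhs_nbhs.
(* The + 1 keeps the denominator positive when both directions vanish. *)
have d0 : 0 < e / (`|v| + `|w| + 1).
  by rewrite divr_gt0// ltr_wpDl// addr_ge0.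
exists (e / (`|v| + `|w| + 1)) => //= h /=; rewrite sub0r normrN => hd.
move=> s t /andP[s0 s1] /andP[t0 t1]; apply: eU; rewrite -ball_normE /=.
rewrite addrA opprD addrCA subrr addr0 normrN.
rewrite ltr_pdivlMr in hd; last by rewrite ltr_wpDl// addr_ge0.
apply: le_lt_trans hd; apply: le_trans (ler_normD _ _) _.
rewrite !normrZ (ger0_norm s0) (ger0_norm t0) 2!mulrDr mulr1.
by rewrite -[leLHS]addr0 lerD// lerD// ler_piMl// mulr_ge0.
Qed.

(** The second difference over the parallelogram with sides h v and h w ignores the order of the
    sides. Using [key] in both orders writes it as h^2 times either mixed derivative at a point near
    [x]; after cancelling h^2, continuity makes the two agree up to any [e]. *)
Lemma schwarz U f v w x : open U -> smooth U f -> U x ->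
  'D_v ('D_w f) x = 'D_w ('D_v f) x.
Proof.
move=> oU.
(* the second difference of [f] divided by [h ^+ 2] is a value of
   ['D_w ('D_v f)] near [x] *)
have key (g : V -> R) a b h : smooth U g ->
    (forall s t : R, 0 <= s <= 1 -> 0 <= t <= 1 ->
      U (s *: (h *: a) + (t *: (h *: b) + x))) -> exists s t : R,
    [/\ 0 <= s <= 1, 0 <= t <= 1 &
      g (h *: a + (h *: b + x)) - g (h *: b + x) - g (h *: a + x) + g x =
      h ^+ 2 * 'D_b ('D_a g) (s *: (h *: a) + (t *: (h *: b) + x))].
  move=> sg Uh.
  have i0 : 0 <= (0 : R) <= 1 by rewrite lexx ler01.
  have i1 : 0 <= (1 : R) <= 1 by rewrite lexx ler01.
  have Ua s : 0 <= s <= 1 -> U (s *: (h *: a) + x).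
    by move=> si; have := Uh s 0 si i0; rewrite scale0r add0r.
  have Uab s : 0 <= s <= 1 -> U (s *: (h *: a) + (h *: b + x)).
    by move=> si; have := Uh s 1 si i1; rewrite scale1r.
  have dg y c : U y -> derivable g y c by move=> Uy; exact: smooth_derivable sg Uy.
  have sga : smooth U ('D_a g) by exact: smooth_derive.
  have shift_dg y c : U (h *: b + y) ->
      is_derive y c (g \o shift (h *: b)) ('D_c g (h *: b + y)).
    move=> Uy; have := dg _ c Uy.
    have E : (fun k : R => k^-1 *: (((g \o shift (h *: b)) \o shift y) (k *: c)
        - (g \o shift (h *: b)) y)) =
      (fun k : R => k^-1 *: ((g \o shift (h *: b + y)) (k *: c) -
        g (h *: b + y))).
      by apply/funext => k /=; rewrite -addrA [y + _]addrC.
    by move=> d; split; rewrite /derivable /derive E.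
  have sb s : h *: b + (s *: (h *: a) + x) = s *: (h *: a) + (h *: b + x).
    by rewrite addrCA.
  have dpsi s : 0 <= s <= 1 -> is_derive (s *: (h *: a) + x) (h *: a)
      (g \o shift (h *: b) - g)
      ('D_(h *: a) g (s *: (h *: a) + (h *: b + x)) -
       'D_(h *: a) g (s *: (h *: a) + x)).
    move=> si; apply: is_deriveB; last by apply/derivableP/dg/Ua.
    by rewrite -sb; apply: shift_dg; rewrite sb; exact: Uab.
  (* The second difference is the increment along h a of y |-> g (y + h b) - g y. One mean value
     along h a, then one along h b, produce the mixed derivative. *)
  have [|s si Es] := @MVT_line (g \o shift (h *: b) - g) x (h *: a).
    by move=> s si; apply: ex_derive; exact: dpsi.
  have Ey t : t *: (h *: b) + (s *: (h *: a) + x) =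
      s *: (h *: a) + (t *: (h *: b) + x) by rewrite addrCA.
  have [|t ti Et] := @MVT_line ('D_a g) (s *: (h *: a) + x) (h *: b).
    move=> t ti; rewrite Ey; apply: smooth_derivable sga _.
    exact: Uh.
  exists s, t; split=> //.
  have -> : g (h *: a + (h *: b + x)) - g (h *: b + x) - g (h *: a + x) + g x =
     (g \o shift (h *: b) - g) (h *: a + x) - (g \o shift (h *: b) - g) x.
    rewrite /= -[RHS]/(g (h *: a + x + h *: b) - g (h *: a + x) -
      (g (x + h *: b) - g x)) -(addrA (h *: a)) !(addrC x).
    by ring.
  rewrite Es (@derive_val _ _ _ _ _ _ _ (dpsi s si)).
  rewrite !derive_scale; [|by apply: dg; first exact: Ua|by apply: dg; exact: Uab].
  rewrite -mulrBr -sb Et derive_scale; first by rewrite Ey mulrA.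
  by rewrite Ey; apply: smooth_derivable sga _; exact: Uh.
move=> sf Ux; apply/eqP; rewrite -subr_eq0 -normr_le0; apply/ler_addgt0Pl => e e0.
rewrite addr0.
have nbh a b : \forall y \near x, `|'D_a ('D_b f) x - 'D_a ('D_b f) y| < e / 2.
  have sab : smooth U ('D_a ('D_b f)) by do 2 apply: smooth_derive.
  have := smooth_continuous sab Ux.
  by move/cvgrPdist_lt; apply; rewrite divr_gt0.
have [B [oB Bx BE]] : exists B, [/\ open B, B x & forall y, B y ->
    [/\ U y, `|'D_v ('D_w f) x - 'D_v ('D_w f) y| < e / 2 &
     `|'D_w ('D_v f) x - 'D_w ('D_v f) y| < e / 2]].
  have : \forall y \near x, [/\ U y, `|'D_v ('D_w f) x - 'D_v ('D_w f) y| < e / 2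
     & `|'D_w ('D_v f) x - 'D_w ('D_v f) y| < e / 2].
    have nU : nbhs x U by exact: open_nbhs_nbhs.
    apply: filterS3 nU (nbh _ _) (nbh _ _) => y Uy; exact: And3.
  rewrite -nbhs_nearE nbhsE => -[B [oB Bx] BE].
  by exists B; split.
have [h [h0 Hvw Hwv]] : exists h : R, [/\ h != 0,
   (forall s t : R, 0 <= s <= 1 -> 0 <= t <= 1 ->
      B (s *: (h *: v) + (t *: (h *: w) + x))) &
   (forall s t : R, 0 <= s <= 1 -> 0 <= t <= 1 ->
      B (s *: (h *: w) + (t *: (h *: v) + x)))].
  apply: (@filter_ex _ (0 : R)^'); near=> h; split.
  - by near: h; exact: nbhs_dnbhs_neq.
  - by near: h; apply: nbhs_dnbhs; exact: near_parallelogram.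
  - by near: h; apply: nbhs_dnbhs; exact: near_parallelogram.
have sfB : smooth U f by [].
have [s [t [si ti E1]]] := key f v w h sf
  (fun s t si ti => let: And3 a _ _ := BE _ (Hvw s t si ti) in a).
have [s' [t' [si' ti' E2]]] := key f w v h sf
  (fun s t si ti => let: And3 a _ _ := BE _ (Hwv s t si ti) in a).
have [_ _ B1] := BE _ (Hvw s t si ti).
have [_ B2 _] := BE _ (Hwv s' t' si' ti').
move: E1 E2 B1 B2; rewrite addrCA [_ - f (h *: w + x) - _]addrAC => ->.
move: ('D_v ('D_w f) x) ('D_w ('D_v f) x) ('D_w _ _) ('D_v _ _) => a b a' b'.
have h2 : h ^+ 2 != 0 by rewrite expf_neq0.
move=> /(mulfI h2) -> B1 B2; apply: ltW; rewrite (splitr e) -(subrKA b').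
by apply: le_lt_trans (ler_normD _ _) _; apply: ltrD => //; rewrite distrC.
Unshelve. all: by end_near. Qed.

(** Directional derivatives need not be additive in the direction in general; continuity of those
    along [v] and [w] forces it. The increment along h (v + w) is a step h w followed by a step h v,
    and each step is a mean value taken near [x]. *)
Lemma derive_addv U f v w x : open U -> smooth U f -> U x ->
  'D_(v + w) f x = 'D_v f x + 'D_w f x.
Proof.
move=> oU sf Ux; apply/eqP; rewrite -subr_eq0 -normr_le0.
apply/ler_addgt0Pl => e e0; rewrite addr0.
have nbh a : \forall y \near x, `|'D_a f x - 'D_a f y| < e / 3.
  have sa : smooth U ('D_a f) by exact: smooth_derive.
  by have := smooth_continuous sa Ux; move/cvgrPdist_lt; apply; rewrite divr_gt0.
have [B [oB Bx BE]] : exists B, [/\ open B, B x & forall y, B y ->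
    [/\ U y, `|'D_v f x - 'D_v f y| < e / 3 & `|'D_w f x - 'D_w f y| < e / 3]].
  have : \forall y \near x, [/\ U y, `|'D_v f x - 'D_v f y| < e / 3 &
      `|'D_w f x - 'D_w f y| < e / 3].
    have nU : nbhs x U by exact: open_nbhs_nbhs.
    apply: filterS3 nU (nbh _) (nbh _) => y Uy; exact: And3.
  rewrite -nbhs_nearE nbhsE => -[B [oB Bx] BE].
  by exists B; split.
have dvw : derivable f x (v + w) by exact: smooth_derivable sf Ux.
have [h [h0 Hh Dh]] : exists h : R, [/\ h != 0,
   (forall s t : R, 0 <= s <= 1 -> 0 <= t <= 1 ->
      B (s *: (h *: v) + (t *: (h *: w) + x))) &
   `|'D_(v + w) f x - h^-1 * (f (h *: (v + w) + x) - f x)| < e / 3].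
  apply: (@filter_ex _ (0 : R)^'); near=> h; split.
  - by near: h; exact: nbhs_dnbhs_neq.
  - by near: h; apply: nbhs_dnbhs; exact: near_parallelogram.
  - near: h; move: dvw => /cvgrPdist_lt; apply; by rewrite divr_gt0.
have i0 : 0 <= (0 : R) <= 1 by rewrite lexx ler01.
have i1 : 0 <= (1 : R) <= 1 by rewrite lexx ler01.
have Bw t : 0 <= t <= 1 -> B (t *: (h *: w) + x).
  by move=> ti; have := Hh 0 t i0 ti; rewrite scale0r add0r.
have Bv s : 0 <= s <= 1 -> B (s *: (h *: v) + (h *: w + x)).
  by move=> si; have := Hh s 1 si i1; rewrite scale1r.
have df y c : B y -> derivable f y c.
  by move=> /BE[Uy _ _]; exact: smooth_derivable sf Uy.
have [|s si Es] := @MVT_line f (h *: w + x) (h *: v).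
  by move=> s si; exact/df/Bv.
have [|t ti Et] := @MVT_line f x (h *: w).
  by move=> t ti; exact/df/Bw.
move: Es Et; rewrite !derive_scale; [|exact/df/Bw|exact/df/Bv] => Es Et.
move: Dh; rewrite scalerDr -addrA.
have -> : f (h *: v + (h *: w + x)) - f x =
    (f (h *: v + (h *: w + x)) - f (h *: w + x)) + (f (h *: w + x) - f x) by ring.
rewrite Es Et -mulrDr mulKf// => Dh.
have [_ B1 _] := BE _ (Bv s si).
have [_ _ B2] := BE _ (Bw t ti).
move: Dh B1 B2; set a := 'D_v f (_ + _); set b := 'D_w f (_ + _) => Dh B1 B2.
have -> : 'D_(v + w) f x - ('D_v f x + 'D_w f x) =
  ('D_(v + w) f x - (a + b)) - ('D_v f x - a) - ('D_w f x - b) by ring.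
apply: ltW; have -> : e = e / 3 + e / 3 + e / 3 by lra.
apply: le_lt_trans (ler_normB _ _) _; rewrite ltrD//.
by apply: le_lt_trans (ler_normB _ _) _; rewrite ltrD.
Unshelve. all: by end_near. Qed.

Lemma derive_sumv U f I (r : seq I) (c : I -> R) (e : I -> V) x :
  open U -> smooth U f -> U x ->
  'D_(\sum_(i <- r) c i *: e i) f x = \sum_(i <- r) c i * 'D_(e i) f x.
Proof.
move=> oU sf Ux; elim: r => [|i r IH]; first by rewrite !big_nil derive0.
rewrite !big_cons (derive_addv _ _ oU sf Ux) IH derive_scale//.
exact: smooth_derivable sf Ux.
Qed.

End second_order.

(** * From directional derivatives to differentials *)

Section differentiability.
Context {R : realType} {n : nat}.

(** Continuous partials suffice: the mean value theorem along [h], with linearity in the direction,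
    writes the remainder as differences of partials times the coordinates of [h]. *)
Lemma smooth_differentiable (U : set 'rV[R]_n) (f : 'rV[R]_n -> R) x :
  open U -> smooth U f -> U x -> differentiable f x.
Proof.
move=> oU sf Ux.
pose df (h : 'rV[R]_n) : R := 'D_h f x.
have lin_df : linear df.
  move=> c v w; rewrite /df (derive_addv _ _ oU sf Ux) derive_scale//.
  exact: smooth_derivable sf Ux.
pose L : {linear 'rV[R]_n -> R} :=
  HB.pack df (GRing.isLinear.Build _ _ _ _ _ lin_df).
have dE y h : U y -> 'D_h f y = \sum_a h 0 a * 'D_(delta_mx 0 a) f y.
  by move=> Uy; rewrite {1}[h]row_sum_delta (derive_sumv _ _ _ oU sf Uy).
have cL : continuous L.
  have -> : (L : _ -> _) = (fun h : 'rV[R]_n =>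
      \sum_a h 0 a * 'D_(delta_mx 0 a) f x).
    by apply/funext => h; exact: dE.
  move=> h; apply: (@cvg_big _ _ _ _ _ _ _ (nbhs h)) => [|a _].
    exact: add_continuous.
  by apply: cvgM; [exact: coord_continuous|exact: cvg_cst].
have exp : f \o shift x = cst (f x) + L +o_ (0 : 'rV[R]_n) id.
  apply/eqaddoP => e e0.
  (* Dividing by n + 1 also covers n = 0. Row vectors carry the maximum norm, so the n coordinate
     errors add up to at most e |h|. *)
  have en : 0 < e / n.+1%:R by rewrite divr_gt0.
  have [B [oB Bx BE]] : exists B, [/\ open B, B x & forall y, B y -> U y /\
     forall a, `|'D_(delta_mx 0 a) f x - 'D_(delta_mx 0 a) f y| < e / n.+1%:R].
    have nU : nbhs x U by exact: open_nbhs_nbhs.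
    have nE : \forall y \near x,
       forall a : 'I_n, `|'D_(delta_mx 0 a) f x - 'D_(delta_mx 0 a) f y| < e / n.+1%:R.
      apply: (@filter_forall _ _ (fun (a : 'I_n) y => `|'D_(delta_mx 0 a) f x -
        'D_(delta_mx 0 a) f y| < e / n.+1%:R) (nbhs x) (nbhs_filter x)) => a.
      have sa : smooth U ('D_(delta_mx 0 a) f) by exact: smooth_derive.
      by have := smooth_continuous sa Ux; move/cvgrPdist_lt; apply.
    have := @filterI _ _ (nbhs_filter x) _ _ nU nE.
    rewrite nbhsE => -[B [oB Bx] BE].
    by exists B; split.
  have /nbhs_ballP[r /= r0 rB] : nbhs x B by exact: open_nbhs_nbhs.
  near=> h.
  have hr : `|h| < r.
    near: h; apply/nbhs_ballP; exists r => //= h.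
    by rewrite -ball_normE /= sub0r normrN.
  have Bh s : 0 <= s <= 1 -> B (s *: h + x).
    move=> /andP[s0 s1]; apply: rB; rewrite -ball_normE /=.
    rewrite opprD addrCA subrr addr0 normrN normrZ ger0_norm//.
    by apply: le_lt_trans hr; rewrite ler_piMl.
  have [|s si Es] := @MVT_line _ _ f x h.
    by move=> s si; have [Uy _] := BE _ (Bh s si); exact: smooth_derivable sf Uy.
  rewrite -[X in `|X|]/(f (h + x) - (f x + 'D_h f x)) opprD addrA Es.
  have [Uy Dy] := BE _ (Bh s si).
  rewrite !dE// -sumrB.
  apply: le_trans (ler_norm_sum _ _ _) _.
  apply: (@le_trans _ _ (\sum_(a < n) (e / n.+1%:R * `|h|))).
    apply: ler_sum => a _; rewrite -mulrBr normrM mulrC ler_pM//.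
      by rewrite distrC ltW.
    rewrite [leRHS]/Num.Def.normr/= mx_normrE.
    exact: (le_bigmax _ _ (0, a)).
  rewrite sumr_const card_ord -[leLHS]mulr_natl mulrA ler_wpM2r//.
  rewrite mulrCA ger_pMr//.
  by rewrite ler_pdivrMr ?mul1r ?ler_nat ?ltr0n.
have E := diff_unique cL exp.
by apply/diff_locallyP; rewrite E; split.
Unshelve. all: by end_near. Qed.

Lemma derive_sum_delta (U : set 'rV[R]_n) (f : 'rV[R]_n -> R) x v :
  open U -> smooth U f -> U x ->
  'D_v f x = \sum_a v 0 a * 'D_(delta_mx 0 a) f x.
Proof.
by move=> oU sf Ux; rewrite {1}[v]row_sum_delta (derive_sumv _ _ _ oU sf Ux).
Qed.

End differentiability.

Section chain_rule.
Context {R : realType} {n m : nat}.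

Lemma smooth_differentiable_rV (U : set 'rV[R]_n) (f : 'rV[R]_n -> 'rV[R]_m) x :
  open U -> (forall b, smooth U (fun y => f y 0 b)) -> U x -> differentiable f x.
Proof.
move=> oU sf Ux.
have -> : f = \sum_(b < m) (fun y => f y 0 b *: (delta_mx 0 b : 'rV[R]_m)).
  apply/funext => y; rewrite fct_sumE {1}(row_sum_delta (f y)).
  by [].
apply: differentiable_sum => b; apply: differentiableZl.
exact: smooth_differentiable (sf b) Ux.
Qed.

Lemma chain_rule (U : set 'rV[R]_n) (O : set 'rV[R]_m)
    (f : 'rV[R]_n -> 'rV[R]_m) (h : 'rV[R]_m -> R) x a :
  open U -> (forall b, smooth U (fun y => f y 0 b)) -> U x ->
  open O -> smooth O h -> O (f x) ->
  'D_(delta_mx 0 a) (h \o f) x =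
  \sum_b jacobian f x a b * 'D_(delta_mx 0 b) h (f x).
Proof.
move=> oU sf Ux oO sh Ofx.
have df := smooth_differentiable_rV oU sf Ux.
have dh := smooth_differentiable oO sh Ofx.
rewrite deriveE; last exact: differentiable_comp.
rewrite diff_comp//= -deriveE// (derive_sum_delta _ oO sh Ofx).
by apply: eq_bigr => b _; rewrite /jacobian [in RHS]mxE.
Qed.

End chain_rule.

(** * Positive definite matrices *)

Section positive_definite.
Context {R : realType}.

Definition posdef n (A : 'M[R]_n) : Prop :=
  A^T = A /\ forall v : 'rV[R]_n, v != 0 -> 0 < bilin A v v.

(** Induction on the size: splitting off the first row and column with pivot [c] leaves the Schur
    complement, which is again positive definite. *)
Lemma cholesky n (A : 'M[R]_n) : posdef A -> exists L : 'M[R]_n, A = L *m L^T.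
Proof.
elim: n A => [|n IH]; first by move=> A _; exists 0; apply/matrixP => -[].
rewrite -[n.+1]/(1 + n)%N => A [sA pA].
rewrite -[A]submxK in sA pA *.
set a := ulsubmx A in sA pA *; set r := ursubmx A in sA pA *.
set r' := dlsubmx A in sA pA *; set B := drsubmx A in sA pA *.
move: sA; rewrite tr_block_mx => /eq_block_mx[_ _ Er sB].
have a0 : 0 < a 0 0.
  have := pA (row_mx 1 0); rewrite /bilin tr_row_mx mul_row_block mul_row_col.
  rewrite !mul1mx !mul0mx !addr0 trmx1 trmx0 mulmx1 mulmx0 addr0; apply.
  by apply/eqP => /eqP; rewrite row_mx_eq0 oner_eq0.
have aE : a = (a 0 0)%:M by rewrite {1}[a]mx11_scalar.
pose c := a 0 0; rewrite -/c in aE a0.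
have c0 : c != 0 by rewrite gt_eqF.
have [|L' EL] := IH (B - c^-1 *: (r^T *m r)).
  split; first by rewrite linearB linearZ /= trmx_mul trmxK sB.
  move=> v v0.
  (* The first coordinate is chosen so that the leading block cancels; the form of [A] at this
     vector is the form of the Schur complement at [v]. *)
  have := pA (row_mx (- c^-1 *: (v *m r^T)) v).
  rewrite /bilin tr_row_mx mul_row_block mul_row_col.
  rewrite aE -Er mul_mx_scalar scalerA mulrN mulfV// scaleN1r addNr mul0mx add0r.
  have -> : (- c^-1 *: (v *m r^T) *m r + v *m B) =
     v *m (B - c^-1 *: (r^T *m r)).
    by rewrite mulmxBr addrC scaleNr mulNmx -scalemxAl -scalemxAr mulmxA.
  apply; apply/eqP => /eqP; rewrite row_mx_eq0 => /andP[_ /eqP v00].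
  by rewrite v00 eqxx in v0.
pose s := Num.sqrt c.
have s0 : s != 0 by rewrite gt_eqF// sqrtr_gt0.
have ss : s * s = c by rewrite -expr2 sqr_sqrtr// ltW.
exists (block_mx s%:M 0 (s^-1 *: r^T) L').
rewrite tr_block_mx mulmx_block trmx0 !mulmx0 !mul0mx !addr0 linearZ /= trmxK.
rewrite tr_scalar_mx -scalar_mxM ss -aE mul_scalar_mx mul_mx_scalar !scalerA.
rewrite mulfV// !scale1r -scalemxAl -scalemxAr scalerA -invfM ss -EL.
by rewrite addrC subrK Er.
Qed.

Lemma posdef_unit n (A : 'M[R]_n) : posdef A -> A \in unitmx.
Proof.
move=> [_ pA]; rewrite -row_free_unit -kermx_eq0; apply/rowV0P => v /sub_kermxP vA.
apply/eqP; apply: contraT => /pA.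
by rewrite /bilin vA mul0mx mxE ltxx.
Qed.

Lemma inv_posdef_factor n (A : 'M[R]_n) : posdef A ->
  exists N : 'M[R]_n, invmx A = N *m N^T.
Proof.
move=> pA; have uA := posdef_unit pA.
have [L EL] := cholesky pA.
have uL : L \in unitmx by move: uA; rewrite EL unitmx_mul => /andP[].
exists (invmx L)^T; rewrite trmxK.
apply: (can_inj (mulKmx uA)); rewrite mulmxV// EL.
by rewrite mulmxA -(mulmxA L) -trmx_mul mulVmx// trmx1 mulmx1 mulmxV.
Qed.

(** With A^-1 = N N^T, cyclicity turns the trace into tr (N^T H N), a sum of values of the form [H]
    on the columns of N. *)
Lemma tr_inv_posdef_le0 n (A H : 'M[R]_n) : posdef A ->
  (forall v, bilin H v v <= 0) -> \tr (invmx A *m H) <= 0.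
Proof.
move=> /inv_posdef_factor[N ->] H0.
rewrite -mulmxA mxtrace_mulC /mxtrace; apply: sumr_le0 => k _.
have := H0 (row k N^T); rewrite /bilin tr_row trmxK -row_mul.
move: (N^T *m H) => K; rewrite [X in X <= _]mxE [X in _ -> X <= _]mxE.
by under eq_bigr do rewrite [row _ _ _ _]mxE [col _ _ _ _]mxE.
Qed.

(** The trace equals tr (K K) for the symmetric K = N^T H N, hence a sum of squares. *)
Lemma tr_inv_posdef_sqr_ge0 n (A H : 'M[R]_n) : posdef A -> H^T = H ->
  0 <= \tr ((invmx A *m H) *m (invmx A *m H)).
Proof.
move=> /inv_posdef_factor[N ->] sH; pose K := N^T *m H *m N.
have -> : \tr (N *m N^T *m H *m (N *m N^T *m H)) = \tr (K *m K).
  by rewrite -!(mulmxA N) mxtrace_mulC /K !mulmxA.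
have sK : K^T = K by rewrite /K !trmx_mul trmxK sH mulmxA.
clearbody K.
rewrite /mxtrace; apply: sumr_ge0 => i _; rewrite mxE; apply: sumr_ge0 => j _.
by have <- : K i j = K j i; [rewrite -[in LHS]sK mxE|rewrite -expr2 sqr_ge0].
Qed.

Lemma bilin_sum n (A : 'M[R]_n) v w :
  bilin A v w = \sum_a \sum_b v 0 a * w 0 b * A a b.
Proof.
rewrite /bilin mxE exchange_big /=; apply: eq_bigr => b _.
rewrite mxE big_distrl /=; apply: eq_bigr => a _.
by rewrite mxE mulrAC.
Qed.

End positive_definite.

(** * Bochner's formula in coordinates *)

(** The index algebra behind the contracted Ricci identity. Read [dGam v d a b] as d_v Gam^d_ab,
    [dx v a] as d_v x^a and [ddx a] as d_a d_c x^a. Having the same [ddx] on both sides encodes that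
    second derivatives commute; what is left over is the curvature. *)
Lemma ricci_identity_algebra (R : comRingType) n (Gam : 'I_n -> 'I_n -> 'I_n -> R)
    (dGam : 'I_n -> 'I_n -> 'I_n -> 'I_n -> R) (x : 'I_n -> R)
    (dx : 'I_n -> 'I_n -> R) (ddx : 'I_n -> R) c :
  (forall d a b, Gam d a b = Gam d b a) ->
  \sum_a (ddx a + \sum_e (Gam a c e * dx a e + dGam a a c e * x e))
  + \sum_a \sum_b Gam a a b * (dx c b + \sum_e Gam b c e * x e)
  - \sum_a \sum_b (dx b a + \sum_e Gam a b e * x e) * Gam b a c =
  \sum_a (ddx a + \sum_e (Gam a a e * dx c e + dGam c a a e * x e))
  + \sum_e (\sum_a (dGam a a c e - dGam c a a e +
     \sum_b (Gam a a b * Gam b c e - Gam a c b * Gam b a e))) * x e.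
Proof.
move=> sym.
(* Symmetry of [Gam] brings these first-order terms into the form in which they cancel those of the
   first sum on the left. *)
have E1 : \sum_a \sum_b (dx b a + \sum_e Gam a b e * x e) * Gam b a c =
    \sum_a \sum_e Gam a c e * dx a e
    + \sum_e \sum_a \sum_b Gam a c b * Gam b a e * x e.
  rewrite exchange_big /= [X in _ = _ + X]exchange_big -big_split /=.
  apply: eq_bigr => a _.
  rewrite [X in _ = _ + X]exchange_big -big_split /=.
  apply: eq_bigr => b _.
  rewrite mulrDl big_distrl /= (sym a b c); congr (_ + _); first exact: mulrC.
  by apply: eq_bigr => e _; rewrite mulrC mulrA.
have E2 : \sum_a \sum_b Gam a a b * (dx c b + \sum_e Gam b c e * x e) =
    \sum_a \sum_e Gam a a e * dx c e
    + \sum_e \sum_a \sum_b Gam a a b * Gam b c e * x e.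
  rewrite [X in _ = _ + X]exchange_big -big_split /=.
  apply: eq_bigr => a _.
  rewrite [X in _ = _ + X]exchange_big -big_split /=.
  apply: eq_bigr => b _.
  rewrite mulrDr big_distrr /=; congr (_ + _).
  by apply: eq_bigr => e _; rewrite mulrA.
have E3 : \sum_e (\sum_a (dGam a a c e - dGam c a a e +
     \sum_b (Gam a a b * Gam b c e - Gam a c b * Gam b a e))) * x e =
  \sum_a \sum_e dGam a a c e * x e - \sum_a \sum_e dGam c a a e * x e
  + \sum_e \sum_a \sum_b Gam a a b * Gam b c e * x e
  - \sum_e \sum_a \sum_b Gam a c b * Gam b a e * x e.
  rewrite [X in _ = X - _ + _ - _]exchange_big.
  rewrite [X in _ = _ - X + _ - _]exchange_big /=.
  rewrite -!sumrB -big_split -!sumrB /=; apply: eq_bigr => e _.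
  rewrite -!sumrB -big_split -!sumrB /= big_distrl; apply: eq_bigr => a _ /=.
  rewrite -[RHS]addrA -sumrB mulrDl mulrBl big_distrl /=; congr (_ + _).
  by apply: eq_bigr => b _; rewrite mulrBl.
have E4 (f g : 'I_n -> 'I_n -> R) : \sum_a (ddx a + \sum_e (f a e + g a e)) =
   \sum_a ddx a + \sum_a \sum_e f a e + \sum_a \sum_e g a e.
  rewrite -addrA -!big_split /=; apply: eq_bigr => a _.
  by rewrite big_split.
by rewrite E1 E2 E3 (E4 _ (fun a e => dGam a a c e * x e))
  (E4 _ (fun a e => dGam c a a e * x e)); ring.
Qed.

Section local_bochner.
Context {R : realType} {V : normedModType R} {n : nat}.
Variables (W : set V) (oW : open W) (e : 'I_n -> V) (G : V -> 'M[R]_n).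
Hypothesis sG : forall a b, smooth W (fun p => G p a b).
Hypothesis pG : forall p, W p -> posdef (G p).

Local Notation D a f := ('D_(e a) f).

(* The objects of Defs with the coordinate directions replaced by fixed vectors
   [e a] of a normed space [V]. With [V] = space-time all fields are jointly
   smooth, and time is just one more direction commuting with the [e a]. *)
Definition Gam (c a b : 'I_n) (p : V) : R :=
  2^-1 * \sum_(l < n) invmx (G p) c l *
    (D a (fun q => G q b l) p + D b (fun q => G q a l) p
     - D l (fun q => G q a b) p).

Definition Riem (d c a b : 'I_n) (p : V) : R :=
  D a (Gam d b c) p - D b (Gam d a c) p
  + \sum_(f < n) (Gam d a f p * Gam f b c p - Gam d b f p * Gam f a c p).

Definition Ric (a b : 'I_n) (p : V) : R := \sum_(c < n) Riem c b c a p.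

Definition Grad (f : V -> R) (a : 'I_n) (p : V) : R :=
  \sum_(b < n) invmx (G p) a b * D b f p.

Definition Div (X : 'I_n -> V -> R) (p : V) : R :=
  \sum_(a < n) (D a (X a) p + \sum_(b < n) Gam a a b p * X b p).

Definition Lap (f : V -> R) : V -> R := Div (Grad f).

Definition grad_sqr (f : V -> R) (p : V) : R :=
  \sum_(a < n) Grad f a p * D a f p.

(* components of the covariant derivative of [Grad f] *)
Definition cov_Grad (f : V -> R) (a b : 'I_n) (p : V) : R :=
  D b (Grad f a) p + \sum_(c < n) Gam a b c p * Grad f c p.

(** Defined by lowering an index of [cov_Grad] rather than from second partials, which makes
    symmetry a theorem. *)
Definition Hess (f : V -> R) (a b : 'I_n) (p : V) : R :=
  \sum_(c < n) G p a c * cov_Grad f c b p.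

Lemma smooth_invmetric a b : smooth W (fun p => invmx (G p) a b).
Proof. by apply: smooth_invmx => // p Wp; exact/posdef_unit/pG. Qed.

Lemma smooth_Gam c a b : smooth W (Gam c a b).
Proof.
apply: smoothM => //; first exact: smooth_cst.
apply: smooth_sum => // l; apply: smoothM => //; first exact: smooth_invmetric.
by apply: smoothB => //; first apply: smoothD => //; apply: smooth_derive.
Qed.

Lemma smooth_Grad f a : smooth W f -> smooth W (Grad f a).
Proof.
move=> sf; apply: smooth_sum => // b; apply: smoothM => //.
  exact: smooth_invmetric.
exact: smooth_derive.
Qed.

Lemma metric_sym p a b : W p -> G p a b = G p b a.
Proof. by move=> /pG[sym _]; rewrite -[in LHS]sym mxE. Qed.

Lemma derive_metric_sym p v a b : W p ->
  'D_v (fun q => G q a b) p = 'D_v (fun q => G q b a) p.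
Proof. by move=> Wp; apply: (eq_derive oW) => // q Wq; exact: metric_sym. Qed.

Lemma Gam_sym p c a b : W p -> Gam c a b p = Gam c b a p.
Proof.
move=> Wp; rewrite /Gam; congr (_ * _); apply: eq_bigr => l _.
by rewrite (derive_metric_sym _ a b Wp) [X in X - _]addrC.
Qed.

(** The right side is the Christoffel symbol of the first kind: the metric cancels its inverse. *)
Lemma lower_Gam p d a b : W p -> \sum_c G p d c * Gam c a b p =
  2^-1 * (D a (fun q => G q b d) p + D b (fun q => G q a d) p
          - D d (fun q => G q a b) p).
Proof.
move=> Wp; rewrite /Gam.
pose T : 'cV[R]_n := \col_l (D a (fun q => G q b l) p + D b (fun q => G q a l) p
     - D l (fun q => G q a b) p).
have E : (G p *m (invmx (G p) *m T)) d 0 = T d 0.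
  by rewrite mulKVmx//; exact/posdef_unit/pG.
rewrite [in RHS]mxE in E; rewrite -E mxE big_distrr /=.
apply: eq_bigr => c _; rewrite mulrCA mxE; congr (_ * (_ * _)).
by apply: eq_bigr => l _; rewrite [in RHS]mxE.
Qed.

(** * Gradient, Hessian and Bochner's formula for a single function *)

Section one_function.
Variables (w : V -> R) (sw : smooth W w).

Local Notation X := (Grad w).
Local Notation S := (cov_Grad w).
Local Notation H := (Hess w).
Local Notation P := (grad_sqr w).

Let sX a : smooth W (X a). Proof. exact: smooth_Grad. Qed.

Lemma smooth_grad_sqr : smooth W P.
Proof.
apply: smooth_sum => // a; apply: smoothM => //; exact: smooth_derive.
Qed.

Lemma smooth_cov_Grad a b : smooth W (S a b).
Proof.
apply: smoothD => //; first exact: smooth_derive.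
by apply: smooth_sum => // f; apply: smoothM => //; exact: smooth_Gam.
Qed.

Lemma metric_Grad p a : W p -> \sum_b G p a b * X b p = D a w p.
Proof.
move=> Wp; pose dw : 'cV[R]_n := \col_l D l w p.
have E : (G p *m (invmx (G p) *m dw)) a 0 = dw a 0.
  by rewrite mulKVmx//; exact/posdef_unit/pG.
rewrite [in RHS]mxE in E; rewrite -E mxE.
apply: eq_bigr => b _; congr (_ * _); rewrite mxE.
by apply: eq_bigr => l _; rewrite [in RHS]mxE.
Qed.

Lemma derive_partial p v a : W p -> 'D_v (D a w) p =
  \sum_b G p a b * 'D_v (X b) p + \sum_b 'D_v (fun q => G q a b) p * X b p.
Proof.
move=> Wp; rewrite -(eq_derive oW _ (fun q Wq => metric_Grad a Wq) Wp).
rewrite (derive_sumE oW)//; last by move=> b; exact: smoothM.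
by rewrite -big_split /=; apply: eq_bigr => b _; rewrite (@deriveME _ _ W).
Qed.

(** The direction is arbitrary: coordinate directions will give the Hessian, the time direction the
    evolution of |grad w|^2. The minus sign in front of the derivative of the metric is what the
    flow inequality is matched with. *)
Lemma derive_grad_sqr p v : W p -> 'D_v P p =
  2 * (\sum_a X a p * 'D_v (D a w) p)
  - \sum_a \sum_b X a p * X b p * 'D_v (fun q => G q a b) p.
Proof.
move=> Wp; rewrite /grad_sqr (derive_sumE oW)//; last first.
  by move=> a; apply: smoothM => //; exact: smooth_derive.
have E : \sum_a 'D_v (fun q => X a q * D a w q) p =
   \sum_a X a p * 'D_v (D a w) p + \sum_a 'D_v (X a) p * D a w p.
  rewrite -big_split /=; apply: eq_bigr => a _.
  by rewrite (@deriveME _ _ W)//; exact: smooth_derive.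
(* Differentiating dw = G X trades the derivative of X for that of dw. *)
have E2 : \sum_a X a p * 'D_v (D a w) p = \sum_a 'D_v (X a) p * D a w p +
   \sum_a \sum_b X a p * X b p * 'D_v (fun q => G q a b) p.
  have -> : \sum_a 'D_v (X a) p * D a w p =
      \sum_a \sum_b X a p * (G p a b * 'D_v (X b) p).
    rewrite exchange_big /=; apply: eq_bigr => a _.
    rewrite -(metric_Grad a Wp) big_distrr /=; apply: eq_bigr => b _.
    by rewrite (metric_sym _ _ Wp) mulrC [RHS]mulrA [X in X * _]mulrC.
  rewrite -big_split /=; apply: eq_bigr => a _.
  rewrite (derive_partial v a Wp) mulrDr !big_distrr /= -big_split /=.
  rewrite -big_split /=; apply: eq_bigr => b _; congr (_ + _).
  by rewrite mulrA mulrAC.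
rewrite E.
have -> : \sum_a 'D_v (X a) p * D a w p = \sum_a X a p * 'D_v (D a w) p -
   \sum_a \sum_b X a p * X b p * 'D_v (fun q => G q a b) p by rewrite E2 addrK.
by ring.
Qed.

(** The classical d_b d_a w - Gam^f_ab d_f w, with first-kind symbols contracted with X so that no
    inverse metric appears. *)
Lemma HessE p a b : W p -> H a b p = D b (D a w) p - 2^-1 *
  \sum_f (D b (fun q => G q a f) p + D a (fun q => G q b f) p
          - D f (fun q => G q b a) p) * X f p.
Proof.
move=> Wp; rewrite /Hess /cov_Grad.
under eq_bigr do rewrite mulrDr big_distrr /=.
rewrite big_split /= exchange_big /=.
have -> : \sum_c G p a c * D b (X c) p =
    D b (D a w) p - \sum_f D b (fun q => G q a f) p * X f p.
  by rewrite (derive_partial (e b) a Wp) addrK.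
rewrite -addrA; congr (_ + _); rewrite big_distrr /= -sumrN -sumrN -big_split /=.
apply: eq_bigr => f _; under eq_bigr do rewrite mulrA.
rewrite -big_distrl /= (lower_Gam a b f Wp).
rewrite (derive_metric_sym (e b) f a Wp) (derive_metric_sym (e f) b a Wp).
by field.
Qed.

Lemma Hess_sym p a b : W p -> H a b p = H b a p.
Proof.
move=> Wp; rewrite (HessE a b Wp) (HessE b a Wp) (schwarz (e b) (e a) oW sw Wp).
congr (_ - _); congr (_ * _); apply: eq_bigr => f _.
by rewrite (derive_metric_sym (e f) b a Wp) [X in X - _]addrC.
Qed.

(** Metric compatibility in coordinates: contracted twice with X, two terms of the first-kind symbol
    cancel, and the surviving d_b of the metric is the one in [derive_grad_sqr]. *)
Lemma derive_grad_sqr_Hess p b : W p -> D b P p = 2 * \sum_a H a b p * X a p.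
Proof.
move=> Wp; rewrite [LHS](derive_grad_sqr (e b) Wp).
have E : \sum_a H a b p * X a p = \sum_a X a p * D b (D a w) p - 2^-1 *
    (\sum_a \sum_f X a p * X f p * D b (fun q => G q a f) p).
  have A0 : \sum_a \sum_f X a p * X f p * D a (fun q => G q b f) p =
      \sum_a \sum_f X a p * X f p * D f (fun q => G q b a) p.
    rewrite exchange_big /=; apply: eq_bigr => a _; apply: eq_bigr => f _.
    by rewrite (mulrC (X f p)).
  have -> : \sum_a \sum_f X a p * X f p * D b (fun q => G q a f) p =
     \sum_a \sum_f X a p * X f p * D b (fun q => G q a f) p +
     (\sum_a \sum_f X a p * X f p * D a (fun q => G q b f) p -
      \sum_a \sum_f X a p * X f p * D f (fun q => G q b a) p).
    by rewrite A0 subrr addr0.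
  rewrite -sumrB -big_split big_distrr /= -sumrB; apply: eq_bigr => a _.
  rewrite (HessE _ _ Wp) -sumrB -big_split /= mulrBl mulrC; congr (_ - _).
  rewrite -mulrA; congr (_ * _); rewrite big_distrl /=.
  by apply: eq_bigr => f _; ring.
by rewrite E mulrBr mulrA mulfV// mul1r.
Qed.

Lemma Grad_grad_sqr p a : W p -> Grad P a p = 2 * \sum_c S a c p * X c p.
Proof.
move=> Wp; rewrite /Grad.
under eq_bigr => b _ do rewrite (derive_grad_sqr_Hess b Wp) mulrCA.
rewrite -big_distrr /=; congr (_ * _).
pose Sm : 'M[R]_n := \matrix_(i, j) S i j p.
pose Xm : 'cV[R]_n := \col_i X i p.
have E : invmx (G p) *m (G p *m Sm *m Xm) = Sm *m Xm.
  by rewrite -mulmxA mulKmx//; exact/posdef_unit/pG.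
transitivity ((Sm *m Xm) a 0); last first.
  by rewrite mxE; apply: eq_bigr => c _; rewrite !mxE.
rewrite -E mxE; apply: eq_bigr => b _; congr (_ * _).
rewrite mxE; apply: eq_bigr => c _; rewrite (Hess_sym _ _ Wp) /Hess [in RHS]mxE.
rewrite [Xm _ _]mxE; congr (_ * _); apply: eq_bigr => d _.
by rewrite [in RHS]mxE.
Qed.

(** The left side is the divergence nabla_a S^a_c. The product rule, and exchanging d_c with d_a on
    X^a, bring both sides to the shape of [ricci_identity_algebra]. *)
Lemma ricci_identity p c : W p ->
  \sum_a D a (S a c) p + \sum_a \sum_b Gam a a b p * S b c p
  - \sum_a \sum_b S a b p * Gam b a c p
  = D c (Lap w) p + \sum_f Ric c f p * X f p.
Proof.
move=> Wp.
have DS v a b : 'D_v (S a b) p = 'D_v (D b (X a)) p + \sum_f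
    (Gam a b f p * 'D_v (X f) p + 'D_v (Gam a b f) p * X f p).
  have sGX f : smooth W (fun q => Gam a b f q * X f q).
    by apply: smoothM => //; exact: smooth_Gam.
  rewrite (@deriveDE _ _ W)//; [|exact: smooth_derive|exact: smooth_sum].
  congr (_ + _); rewrite (derive_sumE oW)//; apply: eq_bigr => f _.
  by rewrite (@deriveME _ _ W)//; exact: smooth_Gam.
have E1 : \sum_a D a (S a c) p = \sum_a (D a (D c (X a)) p + \sum_f
    (Gam a c f p * D a (X f) p + D a (Gam a c f) p * X f p)).
  by apply: eq_bigr => a _; exact: DS.
have E2 : D c (Lap w) p = \sum_a (D a (D c (X a)) p + \sum_f
    (Gam a a f p * D c (X f) p + D c (Gam a a f) p * X f p)).
  apply: etrans (@derive_sumE _ _ W oW _ (index_enum _) xpredT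
    (fun a => S a a) (e c) p (fun a => smooth_cov_Grad a a) Wp) _.
  apply: eq_bigr => a _; apply: etrans (DS (e c) a a) _.
  exact: (congr1 (fun t => t + _) (schwarz (e c) (e a) oW (sX a) Wp)).
rewrite E1 E2.
apply: (@ricci_identity_algebra R n (fun c a b => Gam c a b p)
  (fun v c a b => D v (Gam c a b) p) (fun a => X a p)
  (fun v a => D v (X a) p) (fun a => D a (D c (X a)) p)).
by move=> *; exact: Gam_sym.
Qed.

Lemma bochner p : W p -> Lap P p =
  2 * (\sum_a \sum_c S a c p * S c a p +
       \sum_c X c p * (D c (Lap w) p + \sum_f Ric c f p * X f p)).
Proof.
move=> Wp.
have sSX a : smooth W (fun q => \sum_c S a c q * X c q).
  by apply: smooth_sum => // c; apply: smoothM => //; exact: smooth_cov_Grad.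
rewrite /Lap /Div.
under eq_bigr => a _.
  rewrite (eq_derive oW _ (fun q Wq => Grad_grad_sqr a Wq) Wp).
  rewrite (@derive_cstM _ _ W)// (derive_sumE oW)//; last first.
    by move=> c; apply: smoothM => //; exact: smooth_cov_Grad.
  under eq_bigr => c _.
    rewrite (@deriveME _ _ W)//; last exact: smooth_cov_Grad.
    over.
  under [X in _ + X]eq_bigr => b _ do rewrite (Grad_grad_sqr b Wp) mulrCA.
  rewrite -big_distrr -mulrDr /=.
  over.
rewrite -big_distrr /=; congr (_ * _).
under [X in _ = _ + X]eq_bigr => c _ do rewrite -(ricci_identity c Wp).
under [in LHS]eq_bigr => a _.
  rewrite big_split /= -addrA; over.
rewrite big_split /=.
(* The product rule for the divergence of S X only gives S^a_c d_a X^c. The Christoffel term that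
   completes d_a X^c to S^c_a is exactly the one subtracted in nabla_a S^a_c. *)
have -> : \sum_a \sum_c S a c p * S c a p = \sum_a \sum_c S a c p * D a (X c) p +
    \sum_c X c p * \sum_a \sum_b S a b p * Gam b a c p.
  under [X in _ = _ + X]eq_bigr => c _ do rewrite big_distrr /=.
  rewrite [X in _ = _ + X]exchange_big /= -big_split /=; apply: eq_bigr => a _.
  under [X in _ = _ + X]eq_bigr => c _ do rewrite big_distrr /=.
  rewrite [X in _ = _ + X]exchange_big /= -big_split /=; apply: eq_bigr => c _.
  rewrite [S c a p]/cov_Grad mulrDr; congr (_ + _); rewrite big_distrr /=.
  by apply: eq_bigr => f _; rewrite [RHS]mulrC mulrA.
under [in RHS]eq_bigr => c _ do rewrite mulrBr.
rewrite sumrB -[RHS]addrA; congr (_ + _); rewrite [RHS]addrC subrK.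
under [in RHS]eq_bigr => c _ do rewrite mulrDr !big_distrr /=.
rewrite !big_split /= [X in _ = X + _]exchange_big /=; congr (_ + _).
  by apply: eq_bigr => a _; apply: eq_bigr => c _; rewrite mulrC.
under [in LHS]eq_bigr => a _ do under eq_bigr => b _ do rewrite big_distrr /=.
under [in RHS]eq_bigr => c _ do under eq_bigr => a _ do rewrite big_distrr /=.
rewrite [RHS]exchange_big /=; apply: eq_bigr => a _.
rewrite [RHS]exchange_big /=; apply: eq_bigr => b _.
by apply: eq_bigr => c _; rewrite [RHS]mulrC mulrA.
Qed.

(** This is |Hess w|^2: S itself need not be symmetric, but it is the inverse metric times the
    symmetric [Hess]. *)
Lemma tr_cov_Grad_sqr_ge0 p : W p -> 0 <= \sum_a \sum_c S a c p * S c a p.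
Proof.
move=> Wp; pose Sm : 'M[R]_n := \matrix_(i, j) S i j p.
pose Hm : 'M[R]_n := \matrix_(i, j) H i j p.
have HS : Hm = G p *m Sm.
  apply/matrixP => i j; rewrite !mxE.
  by apply: eq_bigr => c _; rewrite [Sm _ _]mxE.
have sH : Hm^T = Hm by apply/matrixP => i j; rewrite !mxE; exact: Hess_sym.
have := tr_inv_posdef_sqr_ge0 (pG Wp) sH.
rewrite HS mulKmx; last exact/posdef_unit/pG.
move/le_trans; apply; rewrite /mxtrace le_eqVlt; apply/orP; left; apply/eqP.
by apply: eq_bigr => a _; rewrite mxE; apply: eq_bigr => c _; rewrite !mxE.
Qed.

(* Bochner's formula: the Hessian term has a sign, and the Ricci term is
   absorbed by the evolution of the metric. *)
Lemma heat_grad_sqr p (tau : V) : W p ->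
  (forall q, W q -> 'D_tau w q = Lap w q) ->
  (forall x : 'I_n -> R, - 2 * (\sum_a \sum_b x a * x b * Ric a b p) <=
     \sum_a \sum_b x a * x b * 'D_tau (fun q => G q a b) p) ->
  'D_tau P p <= Lap P p.
Proof.
move=> Wp heat flow; rewrite (derive_grad_sqr tau Wp) (bochner Wp).
(* The fixed directions [tau] and [e a] commute, so the heat equation yields d_a (Lap w), which
   cancels the same term in Bochner's formula. *)
have -> : \sum_a X a p * 'D_tau (D a w) p = \sum_a X a p * D a (Lap w) p.
  apply: eq_bigr => a _; congr (_ * _).
  apply: etrans (schwarz tau (e a) oW sw Wp) _.
  exact: (eq_derive oW).
have -> : \sum_c X c p * (D c (Lap w) p + \sum_f Ric c f p * X f p) =
    \sum_a X a p * D a (Lap w) p + \sum_a \sum_b X a p * X b p * Ric a b p.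
  rewrite -big_split /=; apply: eq_bigr => c _; rewrite mulrDr big_distrr /=.
  by congr (_ + _); apply: eq_bigr => f _; rewrite (mulrC (Ric _ _ _)) mulrA.
have := flow (fun a => X a p); have := tr_cov_Grad_sqr_ge0 Wp.
move: (\sum_a X a p * D a (Lap w) p) => A.
move: (\sum_a \sum_c S a c p * S c a p) => B.
move: (\sum_a \sum_b X a p * X b p * Ric a b p) => C.
move: (\sum_a \sum_b _) => E ? ?; lra.
Qed.

(** P is the metric evaluated at X, so P = 0 forces X = 0, and lowering the index gives dw = 0. *)
Lemma grad_sqr_ge0 p : W p -> 0 <= P p /\ (P p = 0 -> forall a, D a w p = 0).
Proof.
move=> Wp; pose x : 'rV[R]_n := \row_a X a p.
have PE : P p = bilin (G p) x x.
  rewrite bilin_sum; apply: eq_bigr => a _; rewrite -(metric_Grad a Wp) big_distrr /=.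
  by apply: eq_bigr => b _; rewrite !mxE (mulrC (G p a b)) mulrA.
rewrite PE; have [x0|x0] := eqVneq x 0.
  rewrite x0; split=> [|_ a]; first by rewrite /bilin mul0mx mul0mx mxE.
  rewrite -(metric_Grad a Wp) big1// => b _.
  by have := congr1 (fun z : 'rV_n => z 0 b) x0; rewrite !mxE => ->; rewrite mulr0.
have [_ /(_ x x0) px] := pG Wp.
by split; [exact: ltW|move=> E; rewrite E ltxx in px].
Qed.


End one_function.

Lemma GradD f h a p : W p -> smooth W f -> smooth W h ->
  Grad (fun q => f q + h q) a p = Grad f a p + Grad h a p.
Proof.
move=> Wp sf sh; rewrite /Grad -big_split /=; apply: eq_bigr => b _.
by rewrite (@deriveDE _ _ W)// mulrDr.
Qed.

Lemma GradM f h a p : W p -> smooth W f -> smooth W h ->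
  Grad (fun q => f q * h q) a p = f p * Grad h a p + h p * Grad f a p.
Proof.
move=> Wp sf sh; rewrite /Grad !big_distrr -big_split /=; apply: eq_bigr => b _.
by rewrite (@deriveME _ _ W)//; ring.
Qed.

Lemma LapD f h p : W p -> smooth W f -> smooth W h ->
  Lap (fun q => f q + h q) p = Lap f p + Lap h p.
Proof.
move=> Wp sf sh; rewrite /Lap /Div -big_split /=; apply: eq_bigr => a _.
rewrite (eq_derive oW _ (fun q Wq => GradD a Wq sf sh) Wp).
rewrite (@deriveDE _ _ W)//; [|exact: smooth_Grad|exact: smooth_Grad].
rewrite addrACA -big_split /=; congr (_ + _); apply: eq_bigr => b _.
by rewrite (GradD b Wp sf sh) mulrDr.
Qed.

(** The two cross terms agree by symmetry of the metric but are kept apart; for f = h = w they add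
    up to 2 |grad w|^2. *)
Lemma LapM f h p : W p -> smooth W f -> smooth W h ->
  Lap (fun q => f q * h q) p = f p * Lap h p + h p * Lap f p
   + \sum_a Grad h a p * D a f p + \sum_a Grad f a p * D a h p.
Proof.
move=> Wp sf sh; have sGf a := smooth_Grad a sf; have sGh a := smooth_Grad a sh.
rewrite /Lap /Div !big_distrr -!big_split /=; apply: eq_bigr => a _.
rewrite (eq_derive oW _ (fun q Wq => GradM a Wq sf sh) Wp).
rewrite (@deriveDE _ _ W)//; [|exact: smoothM|exact: smoothM].
rewrite !(@deriveME _ _ W)//.
have -> : \sum_b Gam a a b p * Grad (fun q => f q * h q) b p =
   f p * \sum_b Gam a a b p * Grad h b p + h p * \sum_b Gam a a b p * Grad f b p.
  rewrite !big_distrr -big_split /=; apply: eq_bigr => b _.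
  by rewrite (GradM b Wp sf sh); ring.
move: (\sum_b Gam a a b p * Grad h b p) (\sum_b Gam a a b p * Grad f b p).
move: (D a (Grad h a) p) (D a (Grad f a) p) (D a f p) (D a h p) => r1 r2 r3 r4.
move: (Grad h a p) (Grad f a p) (f p) (h p) => r5 r6 r7 r8 r9 r0.
by ring.
Qed.

(** At a critical point every first-order term drops out, derivatives of the inverse metric
    included, and the Laplacian is the trace of the inverse metric times the matrix of second
    partials. *)
Lemma Lap_le0 f p : W p -> smooth W f -> (forall a, D a f p = 0) ->
  (forall c : 'I_n -> R, \sum_a \sum_b c a * c b * D a (D b f) p <= 0) ->
  Lap f p <= 0.
Proof.
move=> Wp sf D0 D2.
have G0 b : Grad f b p = 0 by rewrite /Grad big1// => c _; rewrite D0 mulr0.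
pose K : 'M[R]_n := \matrix_(i, j) D i (D j f) p.
have -> : Lap f p = \tr (invmx (G p) *m K).
  rewrite /Lap /Div /mxtrace; apply: eq_bigr => a _.
  rewrite [X in _ + X]big1 => [|b _]; last by rewrite G0 mulr0.
  rewrite addr0 /Grad (derive_sumE oW)//; last first.
    by move=> b; apply: smoothM => //; [exact: smooth_invmetric|exact: smooth_derive].
  rewrite mxE; apply: eq_bigr => b _.
  rewrite (@deriveME _ _ W)//; [|exact: smooth_invmetric|exact: smooth_derive].
  apply: etrans (congr1 (fun t => _ + _ * t) (D0 b)) _.
  rewrite mulr0 addr0 [K b a]mxE.
  exact: (congr1 (fun t => _ * t) (schwarz (e a) (e b) oW sf Wp)).
apply: tr_inv_posdef_le0; first exact: pG.
move=> v; rewrite bilin_sum; under eq_bigr do under eq_bigr do rewrite mxE.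
exact: D2.
Qed.


Lemma Grad_flat f a p : (forall b, D b f p = 0) -> Grad f a p = 0.
Proof. by move=> D0; rewrite /Grad big1// => b _; rewrite D0 mulr0. Qed.

Lemma Lap_flat f p : W p -> (forall q a, W q -> D a f q = 0) -> Lap f p = 0.
Proof.
move=> Wp D0; rewrite /Lap /Div big1// => a _.
rewrite (eq_derive oW (g := fun=> 0) _ _ Wp) => [|q Wq]; last first.
  by apply: Grad_flat => b; exact: D0.
rewrite derive_cst add0r big1// => b _.
by rewrite Grad_flat ?mulr0// => c; exact: D0.
Qed.

(** Meant for constants and functions of time alone, which pass through the Laplacian as
    coefficients. *)
Lemma LapM_flat f h p : W p -> smooth W f -> smooth W h ->
  (forall q a, W q -> D a f q = 0) ->
  Lap (fun q => f q * h q) p = f p * Lap h p.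
Proof.
move=> Wp sf sh D0; rewrite (LapM Wp sf sh) (Lap_flat Wp D0) mulr0 addr0.
rewrite big1 => [|a _]; last by rewrite (D0 p a Wp) mulr0.
rewrite big1 ?addr0// => a _; rewrite Grad_flat ?mul0r// => b.
exact: D0.
Qed.

(* [- eps] makes the subsolution inequality strict, as needed at an interior
   maximum. *)
Lemma bernstein_subsolution (w T : V -> R) (eps : R) p tau :
  W p -> smooth W w -> smooth W T ->
  (forall q, W q -> 'D_tau w q = Lap w q) ->
  (forall x : 'I_n -> R, - 2 * (\sum_a \sum_b x a * x b * Ric a b p) <=
     \sum_a \sum_b x a * x b * 'D_tau (fun q => G q a b) p) ->
  (forall q a, W q -> D a T q = 0) -> 'D_tau T p = 1 -> 0 <= T p ->
  'D_tau (fun q => T q * (2 * grad_sqr w q - eps) + w q * w q) p <=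
  Lap (fun q => T q * (2 * grad_sqr w q - eps) + w q * w q) p - eps.
Proof.
move=> Wp sw sT heat flow DT0 DT1 T0.
have sP : smooth W (grad_sqr w) by exact: smooth_grad_sqr.
have s2 := smooth_cst W (2 : R); have se := smooth_cst W (- eps).
have s2P : smooth W (fun q => 2 * grad_sqr w q) by exact: smoothM.
have sZ : smooth W (fun q => 2 * grad_sqr w q - eps) by exact: smoothD.
have sTZ : smooth W (fun q => T q * (2 * grad_sqr w q - eps)) by exact: smoothM.
have sww : smooth W (fun q => w q * w q) by exact: smoothM.
have LE : Lap (fun q => T q * (2 * grad_sqr w q - eps) + w q * w q) p =
    T p * (2 * Lap (grad_sqr w) p) + (2 * (w p * Lap w p) + 2 * grad_sqr w p).
  rewrite (LapD Wp sTZ sww) (LapM_flat Wp sT sZ DT0) (LapD Wp s2P se).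
  rewrite [X in _ * (_ + X)](@Lap_flat (fun=> - eps) p Wp); last first.
    by move=> q a _; exact: derive_cst.
  rewrite addr0 (LapM_flat Wp s2 sP) ?(LapM Wp sw sw).
    by rewrite /grad_sqr; ring.
  by move=> q a _; exact: derive_cst.
(* As T grows at unit rate, T (2 P - eps) contributes 2 P - eps; this 2 P matches the one coming
   from the Laplacian of w^2. The two sides of the goal then differ by 2 T (Lap P - D_tau P). *)
have DE : 'D_tau (fun q => T q * (2 * grad_sqr w q - eps) + w q * w q) p =
    T p * (2 * 'D_tau (grad_sqr w) p) + (2 * grad_sqr w p - eps) +
    2 * (w p * Lap w p).
  rewrite (@deriveDE _ _ W)// !(@deriveME _ _ W)// DT1 mul1r (heat p Wp).
  rewrite (@deriveDE _ _ W)// (@derive_cstM _ _ W)// derive_cst addr0.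
  by ring.
have := heat_grad_sqr sw Wp heat flow; rewrite LE DE -subr_ge0 => PD.
rewrite -subr_ge0; have := mulr_ge0 T0 PD.
move: (T p) (Lap (grad_sqr w) p) ('D_tau (grad_sqr w) p) => a b c H.
have -> : a * (2 * b) + (2 * (w p * Lap w p) + 2 * grad_sqr w p) - eps -
   (a * (2 * c) + (2 * grad_sqr w p - eps) + 2 * (w p * Lap w p)) =
   2 * (a * (b - c)) by ring.
by rewrite mulr_ge0.
Qed.

End local_bochner.

(** * The maximum principle in space-time *)

Lemma smooth_on_subset (R : realType) (V W : normedModType R) (A B : set V)
    (f : V -> W) : B `<=` A -> smooth_on A f -> smooth_on B f.
Proof.
move=> BA sf x /BA /sf[U [F [oU Ux sF FE]]]; exists U, F; split=> // y By.
exact/FE/BA.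
Qed.

Section maximum.
Context {R : realType} {V : normedModType R}.
Variables (U : set V) (oU : open U) (f : V -> R) (sf : smooth U f).

(** One-sided because a maximum over [t0, t] may occur at the final time, where only earlier times
    can be compared. *)
Lemma derive_ge0_left p v : U p ->
  (\forall s \near (0 : R), 0 < s -> f (- s *: v + p) <= f p) -> 0 <= 'D_v f p.
Proof.
move=> Up nf; rewrite leNgt; apply/negP => D0.
have df : derivable f p v by exact: smooth_derivable sf Up.
have D0' : 0 < - 'D_v f p by rewrite oppr_gt0.
move/cvgrPdist_lt : df => /(_ _ D0')[r /= r0 rP].
move: nf => [r' /= r'0 r'P].
pose s := Num.min r r' / 2.
have s0 : 0 < s by rewrite divr_gt0// lt_min r0.
have sr : s < Num.min r r' by rewrite /s ltr_pdivrMr// ltr_pMr ?ltr1n// lt_min r0.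
move: sr; rewrite lt_min => /andP[sr sr'].
have := rP (- s); rewrite /= sub0r opprK gtr0_norm// => /(_ sr).
rewrite oppr_eq0 gt_eqF// => /(_ isT).
have := r'P s; rewrite /= sub0r normrN gtr0_norm// => /(_ sr' s0) fs.
have q0 : 0 <= (- s)^-1 *: (f (- s *: v + p) - f p).
  have i0 : (- s)^-1 <= 0 by rewrite invr_le0 oppr_le0 ltW.
  have d0 : f (- s *: v + p) - f p <= 0 by rewrite subr_le0.
  exact: mulr_le0.
by move: q0; set q := _ *: _; rewrite -/('D_v f p) ltr_norml => q0 /andP[+ _]; lra.
Qed.

Lemma near_line p v (P : set V) : nbhs p P ->
  \forall s \near (0 : R), P (s *: v + p).
Proof.
move=> nP; have c : (fun s : R => s *: v + p) s @[s --> (0 : R)] --> p.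
  rewrite -[X in _ --> X]add0r -[X in _ --> X + _](scale0r v).
  by apply: cvgD; [apply: cvgZr_tmp; exact: cvg_id|exact: cvg_cst].
exact: c.
Qed.

(** The first derivative follows from the one-sided lemma along v and -v. For the second, a positive
    value would make the first derivative positive just beyond [p], and the mean value theorem would
    then give a larger value of [f]. *)
Lemma derive_max p v : U p ->
  (\forall s \near (0 : R), f (s *: v + p) <= f p) ->
  'D_v f p = 0 /\ 'D_v ('D_v f) p <= 0.
Proof.
move=> Up nf.
have df q w : U q -> derivable f q w by move=> Uq; exact: smooth_derivable sf Uq.
have D0 : 'D_v f p = 0.
  apply/eqP; rewrite eq_le; apply/andP; split; last first.
    apply: derive_ge0_left => //; have [r r0 rP] := nf; exists r => // s /= sr _.
    by apply: rP; rewrite /= sub0r opprK; rewrite sub0r normrN in sr.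
  rewrite -oppr_ge0 -mulN1r -derive_scale; last exact: df.
  apply: derive_ge0_left => //; have [r r0 rP] := nf; exists r => // s /= sr _.
  by rewrite scaleN1r scaleNr scalerN opprK; exact: rP.
split=> //; rewrite leNgt; apply/negP => D2.
have ddf : derivable ('D_v f) p v.
  by apply: smooth_derivable Up; exact: smooth_derive.
have nU : nbhs p U by exact: open_nbhs_nbhs.
move/cvgrPdist_lt : (ddf) => /(_ _ D2)[r1 /= r10 r1P].
have [r2 /= r20 r2P] := near_line v nU.
have [r3 /= r30 r3P] := nf.
pose m := Num.min r1 (Num.min r2 r3); have m0 : 0 < m by rewrite !lt_min r10 r20.
pose s := m / 2.
have s0 : 0 < s by rewrite divr_gt0.
have sm : s < m by rewrite ltr_pdivrMr// ltr_pMr ?ltr1n.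
have : s < m := sm; rewrite !lt_min => /and3P[s1 s2 s3].
have Us t : 0 <= t <= 1 -> U (t *: (s *: v) + p).
  move=> /andP[t0 t1]; rewrite scalerA; apply: r2P; have s0' := ltW s0.
  rewrite /= sub0r normrN ger0_norm; last exact: mulr_ge0.
  by apply: le_lt_trans s2; rewrite ler_piMl.
(* The intermediate point must have t > 0: at [p] itself the first derivative is zero. *)
have mvt := @MVT_line_open _ _ f p (s *: v).
have {mvt}[t t01 E] := mvt (fun r ri => df _ _ (Us r ri)).
move: E; have /andP[t0 t1] := t01.
have ti : 0 <= t <= 1 by rewrite !ltW.
rewrite derive_scale; last exact/df/Us.
have ts0 : 0 < t * s by rewrite mulr_gt0.
have ts1 : t * s < r1 by apply: lt_trans s1; rewrite gtr_pMl.
have := r1P (t * s); rewrite /= sub0r normrN gtr0_norm// => /(_ ts1).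
rewrite gt_eqF// => /(_ isT).
rewrite -/('D_v ('D_v f) p) D0 subr0 -scalerA.
set d := 'D_v f (_ + _); rewrite -[_ *: d]/((t * s)^-1 * d) => dlt.
have d0 : 0 < d.
  have : 0 < (t * s)^-1 * d.
    by move: dlt; rewrite ltr_norml => /andP[_]; rewrite gtrBl.
  by rewrite pmulr_rgt0// invr_gt0.
have := r3P s; rewrite /= sub0r normrN gtr0_norm// => /(_ s3) le E.
by have : 0 < s * d; [exact: mulr_gt0|rewrite -E subr_gt0 ltNge le].
Qed.

End maximum.

(** * Coordinate objects at a fixed time as slices of space-time ones *)

Section spacetime.
Context {R : realType} {n : nat}.
Local Notation E := ('rV[R]_n * R)%type.

Definition edir (a : 'I_n) : E := (delta_mx 0 a, 0).
Definition tdir : E := (0, 1).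

(** The two difference quotients coincide for every increment, so this transfer and those built on
    it need no regularity. *)
Lemma partial_edir (F : E -> R) a y t :
  partial a (fun z => F (z, t)) y = 'D_(edir a) F (y, t).
Proof.
have E0 : (fun h : R => h^-1 *: (((fun z => F (z, t)) \o shift y)
      (h *: delta_mx 0 a) - F (y, t))) =
    (fun h => h^-1 *: ((F \o shift (y, t)) (h *: edir a) - F (y, t))).
  apply/funext => h /=.
  by rewrite -[h *: edir a + _]/((h *: delta_mx 0 a + y, h *: 0 + t)) scaler0 add0r.
by rewrite /partial /derive E0.
Qed.

Lemma christoffel_spacetime (G : E -> 'M[R]_n) c a b y t :
  christoffel (fun z => G (z, t)) c a b y = Gam edir G c a b (y, t).
Proof.
rewrite /christoffel /Gam; congr (_ * _); apply: eq_bigr => l _.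
by rewrite (partial_edir (fun q => G q b l)) (partial_edir (fun q => G q a l))
  (partial_edir (fun q => G q a b)).
Qed.

Lemma partial_christoffel_spacetime (G : E -> 'M[R]_n) d c a b y t :
  partial d (christoffel (fun z => G (z, t)) c a b) y =
  'D_(edir d) (Gam edir G c a b) (y, t).
Proof.
have -> : christoffel (fun z => G (z, t)) c a b =
    (fun z => Gam edir G c a b (z, t)).
  by apply/funext => z; exact: christoffel_spacetime.
exact: partial_edir.
Qed.

Lemma ricci_spacetime (G : E -> 'M[R]_n) a b y t :
  ricci (fun z => G (z, t)) y a b = Ric edir G a b (y, t).
Proof.
rewrite mxE; apply: eq_bigr => c _; rewrite /riemann /Riem.
rewrite !partial_christoffel_spacetime; apply: congr1.
by apply: eq_bigr => f _; rewrite !christoffel_spacetime.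
Qed.

Lemma laplacian_spacetime (G : E -> 'M[R]_n) (F : E -> R) y t :
  laplacian (fun z => G (z, t)) (fun z => F (z, t)) y = Lap edir G F (y, t).
Proof.
have gradE z a : grad (fun z => G (z, t)) (fun z => F (z, t)) z 0 a =
    Grad edir G F a (z, t).
  by rewrite mxE; apply: eq_bigr => b _; rewrite partial_edir.
rewrite /laplacian /divergence /Lap /Div; apply: eq_bigr => a _.
congr (_ + _).
  apply: etrans (partial_edir (Grad edir G F a) a y t).
  by congr (partial a _ y); apply/funext => z; exact: gradE.
by apply: eq_bigr => b _; rewrite gradE christoffel_spacetime.
Qed.

Lemma dt_tdir (F : E -> R) y t : t < 0 -> derivable F (y, t) tdir ->
  dt (fun s => F (y, s)) t = 'D_tdir F (y, t).
Proof.
move=> t0 dF; rewrite /dt.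
(* Uniqueness of the limit requires a proper filter; t - r / 2 is a point of the half-line near [t]
   and distinct from it. *)
have FF : ProperFilter (within [set s : R | s <= 0] t^').
  apply: Build_ProperFilter_ex => P [r /= r0 rP].
  have r2 : 0 < r / 2 by rewrite divr_gt0.
  exists (t - r / 2); apply: rP.
  - rewrite /= opprB addrC subrK gtr0_norm// ltr_pdivrMr// ltr_pMr// ltr1n//.
  - by rewrite lt_eqF// gtrBl.
  - by rewrite /= ltW// (lt_trans _ t0)// gtrBl.
apply/cvg_lim => //; apply/cvgrPdist_lt => e e0.
move/cvgrPdist_lt : dF => /(_ e e0)[r /= r0 rP].
exists r => //= s /=; rewrite distrC => sr st s0.
have := rP (s - t); rewrite /= sub0r normrN => /(_ sr).
rewrite subr_eq0 => /(_ st).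
rewrite -[(s - t) *: tdir + _]/((s - t) *: (0 : 'rV_n) + y, (s - t) * 1 + t).
by rewrite scaler0 add0r mulr1 subrK mulrC.
Qed.

Lemma Ck_slice k (W : set E) (F : E -> R) (t : R) : Ck k W F ->
  Ck k [set y | W (y, t)] (fun y => F (y, t)).
Proof.
have cp (y : 'rV[R]_n) : {for y, continuous (fun z : 'rV[R]_n => (z, t))}.
  have cy : (fun z : 'rV[R]_n => z) z @[z --> y] --> y by exact: cvg_id.
  have ct : (fun=> t : R) @ y --> t by exact: (@cvg_cst _ t _ (nbhs y)).
  exact: (cvg_pair cy ct).
elim: k F => [|k IH] F /= [cF dF].
all: have cs y : W (y, t) -> {for y, continuous (fun z => F (z, t))}
  by move=> Wy; apply: (@continuous_comp _ _ _ (fun z : 'rV[R]_n => (z, t)) F);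
     [exact: cp|exact: cF].
- by split.
- split=> // v; have [dv Cv] := dF (v, 0).
  have E0 y : (fun h : R => h^-1 *: (((fun z => F (z, t)) \o shift y) (h *: v)
        - F (y, t))) =
      (fun h => h^-1 *: ((F \o shift (y, t)) (h *: (v, 0)) - F (y, t))).
    apply/funext => h /=.
    by rewrite -[h *: (v, 0) + _]/((h *: v + y, h *: 0 + t)) scaler0 add0r.
  split=> [y Wy|].
    by rewrite /derivable E0; exact: dv.
  have -> : (fun y => 'D_v (fun z => F (z, t)) y) = (fun y => 'D_(v, 0) F (y, t)).
    by apply/funext => y; rewrite /derive E0.
  exact: (IH _ Cv).
Qed.

Lemma smooth_slice (W : set E) (F : E -> R) (t : R) : smooth W F ->
  smooth [set y | W (y, t)] (fun y => F (y, t)).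
Proof. by move=> sF k; exact: Ck_slice. Qed.

Lemma is_derive_snd (v p : E) : is_derive p v (snd : E -> R) v.2.
Proof.
have c : (fun h : R => h^-1 *: (((snd : E -> R) \o shift p) (h *: v) - p.2))
    @ 0^' --> v.2.
  apply: (@cvg_trans _ (cst v.2 @ (0 : R)^')); last exact: cvg_cst.
  apply: near_eq_cvg; near=> h.
  have h0 : h != 0 by near: h; exact: nbhs_dnbhs_neq.
  apply: (@etrans _ _ (h^-1 * ((h * v.2 + p.2) - p.2))); last by [].
  by rewrite addrK mulKf.
by split; [apply/cvg_ex; exists v.2|exact/cvg_lim].
Unshelve. all: by end_near. Qed.

Lemma smooth_snd (W : set E) : smooth W (snd : E -> R).
Proof.
have cs (p : E) : {for p, continuous (snd : E -> R)}.
  by case: p => y t; exact: cvg_snd.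
move=> [|k]; first by split=> // p _; exact: cs.
split=> [p _|v]; first exact: cs.
split=> [p _|]; first by have [] := is_derive_snd v p.
have -> : (fun p => 'D_v (snd : E -> R) p) = (fun=> v.2).
  by apply/funext => p; have [_ ->] := is_derive_snd v p.
exact: Ck_cst.
Qed.

Lemma vec_spacetime (v : E) : v = \sum_a v.1 0 a *: edir a + v.2 *: tdir.
Proof.
have -> : \sum_a v.1 0 a *: edir a = (v.1, 0).
  rewrite {2}[v.1]row_sum_delta.
  apply: (big_rec2 (fun (x : E) (y : 'rV[R]_n) => x = (y, 0))) => // a x y _ ->.
  rewrite -[LHS]/(v.1 0 a *: delta_mx 0 a + y, v.1 0 a * 0 + 0).
  by rewrite mulr0 addr0.
rewrite -[RHS]/(v.1 + v.2 *: 0, 0 + v.2 * 1) scaler0 addr0 mulr1 add0r.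
by case: v.
Qed.

Lemma derive_spacetime (W : set E) (F : E -> R) p v :
  open W -> smooth W F -> W p ->
  'D_v F p = \sum_a v.1 0 a * 'D_(edir a) F p + v.2 * 'D_tdir F p.
Proof.
move=> oW sF Wp; rewrite {1}(vec_spacetime v) (derive_addv _ _ oW sF Wp).
rewrite (derive_sumv _ _ _ oW sF Wp) derive_scale//.
exact: smooth_derivable sF Wp.
Qed.

Lemma open_prod (T U : topologicalType) (A : set T) (B : set U) :
  open A -> open B -> open (A `*` B).
Proof.
move=> oA oB; rewrite openE => -[x y] [/= Ax By].
by exists (A, B) => //=; split; exact: open_nbhs_nbhs.
Qed.

End spacetime.

(** * The gradient estimate on the manifold *)

Section flow.
Context {R : realType} {n : nat} (M : manifold R n) (g : R -> tensor02 M).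
Hypothesis g_flow : ancient_super_ricci_flow g.
Variable u : M -> R -> R.
Hypothesis u_smooth : ancient_smooth u.
Hypothesis u_heat : ancient_heat_solution g u.
Local Notation E := ('rV[R]_n * R)%type.

Definition cyl (i : atlas M) : set E := (chart i @` dom i) `*` [set t | t < 0].
Definition metric_in (i : atlas M) (p : E) : 'M[R]_n := g p.2 i p.1.
Definition sol_in (i : atlas M) (p : E) : R := u (chartV i p.1) p.2.

Lemma open_cyl i : open (cyl i).
Proof. by apply: open_prod; [exact: chart_open|exact: open_lt]. Qed.

Lemma cyl_chart i (x : M) t : dom i x -> t < 0 -> cyl i (chart i x, t).
Proof. by move=> ix t0; split=> //; exists x. Qed.

Lemma sol_in_chart i (x : M) t : dom i x -> sol_in i (chart i x, t) = u x t.
Proof. by move=> ix; rewrite /sol_in /= chartK. Qed.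

Lemma cyl_le0 i : cyl i `<=` (chart i @` dom i) `*` [set t | t <= 0].
Proof. by move=> p [? /= /ltW]. Qed.

Lemma smooth_metric_in i a b : smooth (cyl i) (fun p => metric_in i p a b).
Proof.
move=> k; have [[_ sg] _] := g_flow.
apply: (@Ck_coord _ _ _ _ _ _ (metric_in i)); first exact: open_cyl.
apply: smooth_on_open; first exact: open_cyl.
exact: smooth_on_subset (@cyl_le0 i) (sg i).
Qed.

Lemma smooth_sol_in i : smooth (cyl i) (sol_in i).
Proof.
move=> k; apply: smooth_on_open; first exact: open_cyl.
exact: smooth_on_subset (@cyl_le0 i) (@u_smooth i).
Qed.

Lemma posdef_metric_in i p : cyl i p -> posdef (metric_in i p).
Proof.
case: p => y t [[x ix /= <-] /= t0]; have [[rg _] _] := g_flow.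
have [_ sym pos _] := rg t (ltW t0); split; first exact: sym.
by move=> v; exact: pos.
Qed.

Lemma heat_sol_in i q : cyl i q ->
  'D_tdir (sol_in i) q = Lap edir (metric_in i) (sol_in i) q.
Proof.
case: q => y t [[x ix /= <-] /= t0].
have dw : derivable (sol_in i) (chart i x, t) tdir.
  by apply: smooth_derivable (@smooth_sol_in i) _; exact: cyl_chart.
rewrite -(dt_tdir t0 dw) -laplacian_spacetime; have := u_heat (ltW t0) ix.
by move=> <-; congr (dt _ t); apply/funext => s; exact: sol_in_chart.
Qed.

Lemma flow_sol_in i p (x : 'I_n -> R) : cyl i p ->
  - 2 * (\sum_a \sum_b x a * x b * Ric edir (metric_in i) a b p) <=
  \sum_a \sum_b x a * x b * 'D_tdir (fun q => metric_in i q a b) p.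
Proof.
case: p => y t [[z iz /= <-] /= t0]; have [_ flow] := g_flow.
pose v : 'rV[R]_n := \row_a x a.
have vE a : v 0 a = x a by rewrite mxE.
have E1 : bilin (ricci (g t i) (chart i z)) v v =
    \sum_a \sum_b x a * x b * Ric edir (metric_in i) a b (chart i z, t).
  rewrite bilin_sum; apply: eq_bigr => a _; apply: eq_bigr => b _.
  by rewrite !vE -(ricci_spacetime (metric_in i)).
have E2 : bilin (dt_metric g t i (chart i z)) v v =
    \sum_a \sum_b x a * x b * 'D_tdir (fun q => metric_in i q a b) (chart i z, t).
  rewrite bilin_sum; apply: eq_bigr => a _; apply: eq_bigr => b _.
  rewrite !vE mxE; apply: (congr1 (fun r => _ * r)).
  apply: (dt_tdir (F := fun q => metric_in i q a b) t0).
  by apply: smooth_derivable (@smooth_metric_in i a b) _; exact: cyl_chart.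
by have := flow t i z v (ltW t0) iz; rewrite E1 E2.
Qed.

Definition grad_sqr_in i : E -> R := grad_sqr edir (metric_in i) (sol_in i).

Lemma smooth_grad_sqr_in i : smooth (cyl i) (grad_sqr_in i).
Proof.
apply: smooth_grad_sqr; [exact: open_cyl|exact: smooth_metric_in|
  exact: posdef_metric_in|exact: smooth_sol_in].
Qed.

(** The inverse chart is continuous on the open image of [chart i], so the preimage of the open set
    [dom j] is open there. *)
Lemma open_overlap (i j : atlas M) : open (chart i @` (dom i `&` dom j)).
Proof.
rewrite openE => y [x [ix jx] <-].
have nO : nbhs (chart i x) (chart i @` dom i).
  by apply: open_nbhs_nbhs; split; [exact: chart_open|exists x].
have nV : nbhs (chart i x) (chartV i @^-1` dom j).
  have cV := @chartV_continuous _ _ M i.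
  rewrite continuous_open_subspace in cV; last exact: chart_open.
  have /cV : chart i x \in chart i @` dom i by rewrite inE; exists x.
  apply; rewrite chartK//; apply: open_nbhs_nbhs.
  by split=> //; exact: dom_open.
have := @filterI _ _ (nbhs_filter (chart i x)) _ _ nO nV.
apply: filterS => z [[x' ix' <-]]; rewrite /= chartK// => jx'.
by exists x'.
Qed.

(** Differentials transform by d_i = J d_j and metrics by G_i = J G_j J^T, so J cancels in d^T G^-1
    d. *)
Lemma grad_sqr_in_overlap i j (x : M) t : dom i x -> dom j x -> t < 0 ->
  grad_sqr_in i (chart i x, t) = grad_sqr_in j (chart j x, t).
Proof.
move=> ix jx t0; set y := chart i x; set z := chart j x.
have [[rg _] _] := g_flow.
have [_ _ _ trans] := rg t (ltW t0).
set tau := chart j \o chartV i; pose J := jacobian tau y.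
have gE : metric_in i (y, t) = J *m metric_in j (z, t) *m J^T by exact: trans.
have ui : metric_in i (y, t) \in unitmx.
  by apply/posdef_unit/posdef_metric_in; exact: cyl_chart.
have uj : metric_in j (z, t) \in unitmx.
  by apply/posdef_unit/posdef_metric_in; exact: cyl_chart.
(* J is a factor of the invertible matrix G_i; the inverse transition map need not be
   differentiated. *)
have uJ : J \in unitmx.
  by move: ui; rewrite gE unitmx_mul => /andP[]; rewrite unitmx_mul => /andP[].
pose di : 'cV[R]_n := \col_a 'D_(edir a) (sol_in i) (y, t).
pose dj : 'cV[R]_n := \col_a 'D_(edir a) (sol_in j) (z, t).
have tauy : tau y = z by rewrite /tau /= chartK.
have dE : di = J *m dj.
  apply/matrixP => a b; rewrite (ord1 b) {b} mxE -partial_edir /partial.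
  have -> : 'D_(delta_mx 0 a) (fun z0 => sol_in i (z0, t)) y =
      'D_(delta_mx 0 a) ((fun z0 => sol_in j (z0, t)) \o tau) y.
    apply: (eq_derive (@open_overlap i j)); last by exists x.
    by move=> _ [x' [ix' jx'] <-]; rewrite /tau /sol_in /= !chartK.
  rewrite (@chain_rule _ _ _ (chart i @` (dom i `&` dom j)) (chart j @` dom j)).
  - by rewrite mxE; apply: eq_bigr => b _; rewrite [dj _ _]mxE -partial_edir tauy.
  - exact: open_overlap.
  - move=> b k; apply: Ck_coord; first exact: open_overlap.
    by apply: smooth_on_open; [exact: open_overlap|exact: transition_smooth].
  - by exists x.
  - exact: chart_open.
  - move=> k; apply: Ck_sub (smooth_slice t (@smooth_sol_in j) k).
    by move=> y' Oy'; split.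
  - by rewrite tauy; exists x.
have gsE k (w : E) (d : 'cV[R]_n) : d = \col_a 'D_(edir a) (sol_in k) w ->
    grad_sqr_in k w = (d^T *m invmx (metric_in k w) *m d) 0 0.
  move=> ->; rewrite -mulmxA mxE; apply: eq_bigr => a _.
  rewrite mulrC 2!mxE; congr (_ * _); rewrite mxE.
  by apply: eq_bigr => b _; rewrite [in RHS]mxE.
rewrite (gsE i _ di erefl) (gsE j _ dj erefl) dE gE.
have invM (A B : 'M[R]_n) : A \in unitmx -> B \in unitmx ->
    invmx (A *m B) = invmx B *m invmx A.
  move=> uA uB; have uAB : A *m B \in unitmx by rewrite unitmx_mul uA.
  apply: (can_inj (mulKmx uAB)); rewrite mulmxV// -mulmxA mulKVmx//.
  by rewrite mulmxV.
rewrite !invM ?unitmx_mul ?unitmx_tr ?uJ// trmx_mul -!mulmxA mulKmx//.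
by rewrite [J^T *m _]mulmxA mulmxV ?unitmx_tr// mul1mx.
Qed.

Definition chart_at (x : M) : atlas M := projT1 (cid (dom_cover x)).

Lemma dom_chart_at x : dom (chart_at x) x.
Proof. exact: (projT2 (cid (dom_cover x))). Qed.

(** The chart is chosen arbitrarily at each point; continuity in [p] rests on independence of that
    choice. *)
Definition grad_sqr_on (p : M * R) : R :=
  grad_sqr_in (chart_at p.1) (chart (chart_at p.1) p.1, p.2).

Lemma grad_sqr_onE i (x : M) t : dom i x -> t < 0 ->
  grad_sqr_on (x, t) = grad_sqr_in i (chart i x, t).
Proof. by move=> ix t0; apply: grad_sqr_in_overlap => //; exact: dom_chart_at. Qed.

Lemma continuous_chart i (x : M) : dom i x -> {for x, continuous (chart i)}.
Proof.
move=> ix; have cC := @chart_continuous _ _ M i.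
rewrite continuous_open_subspace in cC; last exact: dom_open.
by apply: cC; rewrite inE.
Qed.

Lemma continuous_in_chart (F : M * R -> R) (Fi : E -> R) i (x : M) t :
  smooth (cyl i) Fi -> dom i x -> t < 0 ->
  (forall x' t', dom i x' -> t' < 0 -> F (x', t') = Fi (chart i x', t')) ->
  {for (x, t), continuous F}.
Proof.
move=> sF ix t0 FE.
pose G (p : M * R) : E := (chart i p.1, p.2).
have cG : {for (x, t), continuous G}.
  have c1 : (fun p : M * R => chart i p.1) @ (x, t) --> chart i x.
    apply: (@continuous_comp _ _ _ (fst : M * R -> M) (chart i) (x, t)).
      exact: cvg_fst.
    exact: continuous_chart.
  have c2 : (fun p : M * R => p.2) @ (x, t) --> t by exact: cvg_snd.
  exact: (cvg_pair c1 c2).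
have cFG : {for (x, t), continuous (Fi \o G)}.
  apply: (@continuous_comp _ _ _ G Fi (x, t)) => //.
  apply: smooth_continuous sF _; exact: cyl_chart.
have FG : \forall p \near (x, t), ((Fi \o G) p = F p :> R).
  apply: (@near_open _ (dom i `*` [set t : R | t < 0])) => //.
    by apply: open_prod; [exact: dom_open|exact: open_lt].
  by move=> [x' t'] [/= ix' t'0]; exact/esym/FE.
apply: cvg_trans (near_eq_cvg FG) _.
by rewrite (FE x t ix t0); exact: cFG.
Qed.

(** * The barrier function and the maximum principle *)

Section barrier.
Variables (t0 eps : R).

(** At time [t0] it reduces to u^2 whatever [eps] is; this is where the bound A^2 enters. *)
Definition barrier (p : M * R) : R :=
  (p.2 - t0) * (2 * grad_sqr_on p - eps) + u p.1 p.2 * u p.1 p.2.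

Definition barrier_in i (q : E) : R :=
  (q.2 - t0) * (2 * grad_sqr_in i q - eps) + sol_in i q * sol_in i q.

Lemma barrierE i (x : M) t : dom i x -> t < 0 ->
  barrier (x, t) = barrier_in i (chart i x, t).
Proof.
by move=> ix tn; rewrite /barrier /barrier_in (grad_sqr_onE ix tn) sol_in_chart.
Qed.

Lemma smooth_barrier_in i : smooth (cyl i) (barrier_in i).
Proof.
have oW := @open_cyl i.
apply: smoothD => //; apply: smoothM => //; try exact: smooth_sol_in.
- by apply: smoothB => //; [exact: smooth_snd|exact: smooth_cst].
- apply: smoothB => //; last exact: smooth_cst.
  by apply: smoothM => //; [exact: smooth_cst|exact: smooth_grad_sqr_in].
Qed.

(** At such a point the time derivative is >= 0 and the Laplacian <= 0, while the subsolution
    inequality puts the former at most at the latter minus [eps]. *)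
Lemma barrier_no_interior_max x t : 0 < eps -> t0 < t -> t < 0 ->
  ~ (forall x' t', t0 <= t' <= t -> barrier (x', t') <= barrier (x, t)).
Proof.
move=> eps0 t0t tn bmax; pose i := chart_at x.
have ix : dom i x by exact: dom_chart_at.
have oW := @open_cyl i; have sB := @smooth_barrier_in i.
pose p : E := (chart i x, t); have Wp : cyl i p by exact: cyl_chart.
have le_p y s : cyl i (y, s) -> t0 <= s <= t -> barrier_in i (y, s) <= barrier_in i p.
  move=> [[x' ix' /= <-] /= sn] st; rewrite /p -!barrierE//; exact: bmax.
have Dt : 0 <= 'D_tdir (barrier_in i) p.
  apply: (derive_ge0_left sB Wp); exists (t - t0); first by rewrite /= subr_gt0.
  move=> s /=; rewrite sub0r normrN => + s0; rewrite gtr0_norm// => st.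
  rewrite -[- s *: tdir + p]/(- s *: (0 : 'rV_n) + chart i x, - s * 1 + t).
  rewrite scaler0 add0r mulr1; have st' : t0 <= - s + t <= t.
    by apply/andP; split; lra.
  by apply: le_p => //; apply: cyl_chart => //; lra.
have Dx (v : 'rV[R]_n) : 'D_(v, 0) (barrier_in i) p = 0 /\
    'D_(v, 0) ('D_(v, 0) (barrier_in i)) p <= 0.
  apply: (derive_max oW sB Wp).
  have nW : nbhs p (cyl i) by exact: open_nbhs_nbhs.
  have := near_line (v, 0) nW; apply: filterS => s.
  rewrite -[s *: (v, 0) + p]/((s *: v + chart i x, s * 0 + t) : E) mulr0 add0r => Ws.
  by apply: le_p => //; rewrite (ltW t0t) lexx.
have L0 : Lap edir (metric_in i) (barrier_in i) p <= 0.
  apply: (Lap_le0 oW (@smooth_metric_in i) (@posdef_metric_in i) Wp sB).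
    by move=> a; have [] := Dx (delta_mx 0 a).
  (* Testing the matrix of second partials against [c] is the second derivative in the constant
     direction (c, 0), whose sign is known. *)
  move=> c; have [_] := Dx (\row_a c a); set v : E := (_, 0).
  have v1 a : v.1 0 a = c a by rewrite mxE.
  have DvE q : cyl i q -> 'D_v (barrier_in i) q =
      \sum_b c b * 'D_(edir b) (barrier_in i) q.
    move=> Wq; rewrite (derive_spacetime _ oW sB Wq) mul0r addr0.
    by apply: eq_bigr => b _; rewrite v1.
  have sb b : smooth (cyl i) (fun q => c b * 'D_(edir b) (barrier_in i) q).
    by apply: smoothM => //; [exact: smooth_cst|exact: (smooth_derive (edir b) sB)].
  have DDvE a : 'D_(edir a) ('D_v (barrier_in i)) p =
      \sum_b c b * 'D_(edir a) ('D_(edir b) (barrier_in i)) p.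
    apply: etrans (eq_derive oW (edir a) DvE Wp) _.
    apply: etrans (derive_sumE oW (index_enum _) xpredT (edir a) sb Wp) _.
    apply: eq_bigr => b _.
    exact: (derive_cstM (c b) (edir a) (smooth_derive (edir b) sB) Wp).
  have sv : smooth (cyl i) ('D_v (barrier_in i)) := smooth_derive v sB.
  have DvDv : 'D_v ('D_v (barrier_in i)) p =
      \sum_a \sum_b c a * c b * 'D_(edir a) ('D_(edir b) (barrier_in i)) p.
    apply: etrans (derive_spacetime v oW sv Wp) _; rewrite mul0r addr0.
    apply: eq_bigr => a _; apply: etrans (congr2 *%R (v1 a) (DDvE a)) _.
    rewrite big_distrr /=; by apply: eq_bigr => b _; rewrite mulrA.
  by move=> D2; exact: (eq_ind _ (fun r => r <= 0) D2 _ DvDv).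
have sT : smooth (cyl i) (fun q : E => q.2 - t0).
  by apply: smoothB => //; [exact: smooth_snd|exact: smooth_cst].
have DT (q v : E) : 'D_v (fun q : E => q.2 - t0) q = v.2.
  rewrite (@deriveBE _ _ setT)//; [|exact: smooth_snd|exact: smooth_cst].
  by rewrite derive_cst subr0; have [_ ->] := is_derive_snd v q.
have := @bernstein_subsolution _ _ _ _ oW edir _ (@smooth_metric_in i)
  (@posdef_metric_in i) (sol_in i) (fun q : E => q.2 - t0) eps p tdir Wp
  (@smooth_sol_in i) sT (@heat_sol_in i) (fun x => flow_sol_in x Wp)
  (fun q a _ => DT q (edir a)) (DT p tdir).
rewrite subr_ge0 => /(_ (ltW t0t)).
rewrite -/(grad_sqr_in i) -/(barrier_in i) => sub.
by move: Dt L0 sub eps0; move: ('D_tdir _ _) (Lap _ _ _ _) => a b; lra.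
Qed.

End barrier.

(** * Vanishing of the gradient and constancy of the solution *)

Hypothesis M_compact : compact [set: M].
Variable A : R.
Hypothesis u_bound : forall (x : M) (t : R), t <= 0 -> 0 < u x t <= A.

(** Compactness of M x [t0, t] provides a maximum point, which cannot lie after [t0]. *)
Lemma barrier_le t0 eps x t : 0 < eps -> t0 < t -> t < 0 ->
  barrier t0 eps (x, t) <= A * A.
Proof.
move=> eps0 t0t tn.
have K0 : ([set: M] `*` `[t0, t]%classic) !=set0.
  by exists (x, t); split=> //=; rewrite in_itv /= lexx (ltW t0t).
have cK : compact ([set: M] `*` `[t0, t]%classic).
  by apply: compact_setX => //; exact: segment_compact.
have [|[xm tm]] := compact_EVT_max K0 cK (f := barrier t0 eps).
  apply: continuous_in_subspaceT => -[y s]; rewrite inE => -[_ /=].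
  rewrite in_itv /= => /andP[_ st].
  have sn : s < 0 by exact: le_lt_trans st tn.
  apply: (@continuous_in_chart _ _ (chart_at y) y s (@smooth_barrier_in t0 eps _)) => //.
    exact: dom_chart_at.
  by move=> x' t' ix' t'0; exact: barrierE.
rewrite inE => -[_ /=]; rewrite in_itv /= => /andP[t0m mt] bmax.
have bm y s : t0 <= s <= t -> barrier t0 eps (y, s) <= barrier t0 eps (xm, tm).
  by move=> st; apply: bmax; rewrite inE; split=> //=; rewrite in_itv.
have tmn : tm < 0 by exact: le_lt_trans mt tn.
have tmE : tm = t0.
  apply/eqP; rewrite eq_le t0m andbT leNgt; apply/negP => t0tm.
  apply: (barrier_no_interior_max eps0 t0tm tmn (x := xm)) => y s /andP[s0 s1].
  by apply: bm; rewrite s0 (le_trans s1).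
apply: le_trans (bm x t _) _; first by rewrite (ltW t0t) lexx.
rewrite /barrier tmE /= subrr mul0r add0r.
have /andP[u0 uA] := u_bound xm (ltW (lt_trans t0t tn)).
by rewrite ler_pM// ltW.
Qed.

Lemma grad_sqr_on_eq0 x t : t < 0 -> grad_sqr_on (x, t) = 0.
Proof.
move=> tn; set q := grad_sqr_on (x, t).
have q0 : 0 <= q.
  rewrite /q (grad_sqr_onE (dom_chart_at x) tn).
  have Wp := cyl_chart (dom_chart_at x) tn.
  by have [] := grad_sqr_ge0 edir (@posdef_metric_in (chart_at x))
    (sol_in (chart_at x)) Wp.
apply/eqP; move: q0; rewrite le_eqVlt => /orP[/eqP<-//|q0].
have AA : 0 <= A * A by rewrite -expr2 sqr_ge0.
(* With eps = q and (t - t0) q = A^2 + 1, the barrier at (x, t) equals A^2 + 1 + u^2, above its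
   bound A^2. *)
have d0 : 0 < (A * A + 1) / q by rewrite divr_gt0// ltr_wpDl.
have t0t : t - (A * A + 1) / q < t by rewrite gtrBl.
have := barrier_le x q0 t0t tn; rewrite /barrier /= -/q subKr.
have -> : (A * A + 1) / q * (2 * q - q) = A * A + 1.
  by have q0' : q != 0; [rewrite gt_eqF|field].
have := sqr_ge0 (u x t); rewrite expr2; lra.
Qed.

(** Spatial derivatives vanish on the whole cylinder, hence so does the Laplacian, and the heat
    equation removes the time derivative. *)
Lemma derive_sol_in_eq0 i p v : cyl i p -> 'D_v (sol_in i) p = 0.
Proof.
move=> Wp; have D0 q a : cyl i q -> 'D_(edir a) (sol_in i) q = 0.
  move=> Wq; have [_] := grad_sqr_ge0 edir (@posdef_metric_in i) (sol_in i) Wq.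
  apply; rewrite -/(grad_sqr_in i); case: q Wq => y t [[x ix /= <-] /= tn].
  by rewrite -(grad_sqr_onE ix tn) grad_sqr_on_eq0.
rewrite (derive_spacetime _ (@open_cyl i) (@smooth_sol_in i) Wp).
rewrite (heat_sol_in Wp) (Lap_flat (@open_cyl i) (metric_in i) Wp D0) mulr0 addr0.
by rewrite big1// => a _; rewrite D0 ?mulr0.
Qed.

Lemma sol_time_constant x s t : s < 0 -> t < 0 -> u x s = u x t.
Proof.
move=> sn tn; pose i := chart_at x; have ix : dom i x by exact: dom_chart_at.
have line (r : R) : r *: ((0, s - t) : E) + (chart i x, t) =
    (chart i x, r * (s - t) + t).
  by rewrite -[LHS]/(r *: (0 : 'rV_n) + chart i x, r * (s - t) + t) scaler0 add0r.
have Wr r : 0 <= r <= 1 -> cyl i (r *: ((0, s - t) : E) + (chart i x, t)).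
  move=> /andP[r0 r1]; rewrite line; apply: cyl_chart => //; nra.
have dr r : 0 <= r <= 1 ->
    derivable (sol_in i) (r *: ((0, s - t) : E) + (chart i x, t)) (0, s - t).
  by move=> r01; apply: smooth_derivable (@smooth_sol_in i) _; exact: Wr.
have [r r01] := MVT_line dr.
rewrite derive_sol_in_eq0; last exact: Wr.
have -> : (0, s - t) + (chart i x, t) = (chart i x, s) :> E.
  by rewrite -[LHS]/(0 + chart i x, s - t + t) add0r subrK.
by rewrite !sol_in_chart// => /eqP; rewrite subr_eq0 => /eqP.
Qed.

(** The chart image contains a ball around [chart i x]; balls are convex, so the mean value theorem
    applies on segments from the centre. *)
Lemma sol_locally_constant x t : t < 0 -> \forall y \near x, u y t = u x t.
Proof.
move=> tn; pose i := chart_at x; have ix : dom i x by exact: dom_chart_at.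
have /nbhs_ballP[r /= r0 rB] : nbhs (chart i x) (chart i @` dom i).
  by apply: open_nbhs_nbhs; split; [exact: chart_open|exists x].
have nB : \forall y \near x, ball (chart i x) r (chart i y).
  by apply: continuous_chart ix _ _; exact: nbhsx_ballx.
have nD : \forall y \near x, dom i y.
  by apply: open_nbhs_nbhs; split; [exact: dom_open|].
apply: filterS2 nB nD => y; rewrite -ball_normE /= => yr iy.
set v := chart i y - chart i x.
have line (s : R) : s *: ((v, 0) : E) + (chart i x, t) =
    (s *: v + chart i x, t).
  by rewrite -[LHS]/(s *: v + chart i x, s * 0 + t) mulr0 add0r.
have Ws s : 0 <= s <= 1 -> cyl i (s *: ((v, 0) : E) + (chart i x, t)).
  move=> /andP[s0 s1]; rewrite line; split=> //=; apply: rB.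
  rewrite -ball_normE /= opprD addrCA subrr addr0 normrN normrZ ger0_norm//.
  by apply: le_lt_trans yr; rewrite /v distrC ler_piMl.
have ds s : 0 <= s <= 1 ->
    derivable (sol_in i) (s *: ((v, 0) : E) + (chart i x, t)) (v, 0).
  by move=> s01; apply: smooth_derivable (@smooth_sol_in i) _; exact: Ws.
have [s s01] := MVT_line ds.
rewrite derive_sol_in_eq0; last exact: Ws.
have -> : (v, 0) + (chart i x, t) = (chart i y, t) :> E.
  by rewrite -[LHS]/(v + chart i x, 0 + t) subrK add0r.
by rewrite !sol_in_chart// => /eqP; rewrite subr_eq0 => /eqP.
Qed.

Hypothesis M_connected : connected [set: M].

(** By local constancy both a level set and its complement are open. *)
Lemma sol_space_constant x y t : t < 0 -> u x t = u y t.
Proof.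
move=> tn; pose B := [set z | u z t = u y t].
have oB : open B.
  rewrite openE => z Bz; apply: filterS (sol_locally_constant z tn) => z' /= zz'.
  by rewrite /B /= zz'.
have oC : open (~` B).
  rewrite openE => z Bz; apply: filterS (sol_locally_constant z tn) => z' /= zz'.
  by rewrite /setC /B /= zz'.
have BT : B = setT.
  apply: M_connected; first by exists y.
    by exists B => //; rewrite setTI.
  by exists B; [rewrite -[B]setCK; exact: open_closedC|rewrite setTI].
by have : B x by rewrite BT.
Qed.

(** Time 0 lies outside the open cylinders. The local extension [F] is continuous there and agrees
    with [u] at nearby earlier times, where the value is [c]. *)
Lemma sol_at0 x c : (forall t, t < 0 -> u x t = c) -> u x 0 = c.
Proof.
move=> uc; pose i := chart_at x; have ix : dom i x by exact: dom_chart_at.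
have A0 t : t <= 0 -> ((chart i @` dom i) `*` [set t : R | t <= 0]) (chart i x, t).
  by move=> tn; split=> //; exists x.
have [U [F [oU Ux CF FE]]] := @u_smooth i (chart i x, 0) (A0 0 (lexx _)).
have FE' t : t <= 0 -> U (chart i x, t) -> F (chart i x, t) = u x t.
  by move=> tn Ut; rewrite (FE _ (A0 t tn) Ut) /= chartK.
have cF : {for (chart i x, 0), continuous F} by have [cF _] := CF 0%N; exact: cF.
apply/eqP; rewrite -subr_eq0 -normr_le0; apply/ler_addgt0Pl => e e0.
rewrite addr0.
have nF : \forall p \near (chart i x, 0 : R),
    U p /\ `|F (chart i x, 0) - F p| < e.
  have nU : nbhs ((chart i x, 0) : E) U by exact: open_nbhs_nbhs.
  move/cvgrPdist_lt : cF => /(_ e e0) nFe.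
  exact: (@filterI _ _ (nbhs_filter ((chart i x, 0) : E)) _ _ nU nFe).
have [r /= r0 rP] := near_line tdir nF.
have r2 : 0 < r / 2 by rewrite divr_gt0.
have := rP (- (r / 2)); rewrite /= sub0r opprK gtr0_norm//.
rewrite -[- (r / 2) *: tdir + _]/((- (r / 2) *: (0 : 'rV_n) + chart i x, - (r / 2) * 1 + 0)).
rewrite scaler0 add0r mulr1 addr0 ltr_pdivrMr// ltr_pMr// ltr1n => /(_ isT)[Ur].
have rn : - (r / 2) < 0 by rewrite oppr_lt0.
by rewrite (FE' _ (lexx _) Ux) (FE' _ (ltW rn) Ur) (uc _ rn) => /ltW.
Qed.

Lemma sol_constant : exists c : R, forall (x : M) (t : R), t <= 0 -> u x t = c.
Proof.
(* Connectedness admits the empty manifold, for which any constant will do. *)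
have [[x0 _]|M0] := pselect ([set: M] !=set0); last first.
  by exists 0 => x; case: M0; exists x.
have neg x t : t < 0 -> u x t = u x0 (-1).
  by move=> tn; rewrite (sol_space_constant x x0 tn); apply: sol_time_constant.
(* Time -1 is an arbitrary negative reference time. *)
exists (u x0 (-1)) => x t; rewrite le_eqVlt => /orP[/eqP->|]; last exact: neg.
by apply: sol_at0 => s; exact: neg.
Qed.

End flow.

Theorem corollary3p6 (R : realType) (n : nat) (M : manifold R n)
    (M_compact : compact [set: M]) (M_connected : connected [set: M])
    (g : R -> tensor02 M) (g_flow : ancient_super_ricci_flow g)
    (u : M -> R -> R) (u_smooth : ancient_smooth u)
    (u_pos : forall (x : M) (t : R), t <= 0 -> 0 < u x t)
    (u_bounded : exists A : R, 0 < A /\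
       forall (x : M) (t : R), t <= 0 -> u x t <= A)
    (u_heat : ancient_heat_solution g u) :
  exists c : R, forall (x : M) (t : R), t <= 0 -> u x t = c.
Proof.
have [A [_ uA]] := u_bounded.
apply: (sol_constant g_flow u_smooth u_heat M_compact (A := A)) => // x t t0.
by rewrite u_pos ?uA.
Qed.
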